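(* Let $R$ be a commutative ring, $\sigma\in\mathrm{Aut}(R)$ with $\sigma^p=\mathrm{Id}_R$, $\omega=\{\mathfrak m_0,\dots,\sigma^{p-1}(\mathfrak m_0)\}$ a $\sigma$-orbit in $\mathrm{MaxSpec}(R)$ with $p$ elements, and $t,t'\in R$ regular elements. Let $w=w_{i+1}\cdots w_{i+\ell}\in\mathbf D^t_\omega$ be such that $V^t(\omega,i,w)$ is defined, and $w'=w'_1\cdots w'_{rp}\in\mathbf D^{t'}_\omega$. Then, as $A(tt')$-modules, $$V^t(\omega,i,w)\otimes_RV^{t'}(\omega,w',x-1)\simeq\bigoplus_{j=0}^{r-1}V^{tt'}(\omega,i,w^{[j]}),$$ where $w^{[j]}=(w_{i+1}\cdot w'_{i+1+jp})\cdots(w_{i+\ell}\cdot w'_{i+\ell+jp})$, with indices of $w'$ taken modulo $rp$.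
   Context: $A(t)$ is the ring generated over $R$ by $X,Y$ with $Xr=\sigma(r)X$, $Yr=\sigma^{-1}(r)Y$ ($r\in R$), $YX=t$, $XY=\sigma(t)$. A weight module is an $A(t)$-module $M=\bigoplus_{\mathfrak m\in\mathrm{MaxSpec}(R)}M_{\mathfrak m}$, $M_{\mathfrak m}=\{v\mid\mathfrak mv=0\}$. For a weight $A(t)$-module $M$ and a weight $A(t')$-module $M'$, $M\otimes_RM'$ is an $A(tt')$-module via $X(v\otimes v')=Xv\otimes Xv'$, $Y(v\otimes v')=Yv\otimes Yv'$. $B^t_\omega=\{\mathfrak m\in\omega\mid t\in\mathfrak m\}$. $\mathbf D^t_\omega$ is the set of indexed words $w=w_jw_{j+1}\cdots w_{j+m}$ with letters $w_k\in\{1,x,y,0\}$ such that $w_k=1$ iff $\sigma^k(\mathfrak m_0)\notin B^t_\omega$. For $0\le i\le p-1$ with $\sigma^i(\mathfrak m_0)\in B^t_\omega$ and $w=w_{i+1}\cdots w_{i+\ell}\in\mathbf D^t_\omega$ ($\ell\ge0$) with $\sigma^{i+\ell+1}(\mathfrak m_0)\in B^t_\omega$, $V^t(\omega,i,w)=\bigoplus_{i+1\le k\le i+\ell+1}(R/\sigma^k(\mathfrak m_0))e_k$ with $Xe_k=\sigma(t)e_{k+1}$ if $k\ne i+\ell+1,w_k=1$; $e_{k+1}$ if $k\ne i+\ell+1,w_k=x$; $0$ if $k=i+\ell+1$ or $w_k\in\{y,0\}$; $Ye_k=e_{k-1}$ if $k\ne i+1,w_{k-1}\in\{1,y\}$;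 $0$ if $k=i+1$ or $w_{k-1}\in\{x,0\}$. For $w'=w'_1\cdots w'_{rp}\in\mathbf D^{t'}_\omega$, $V^{t'}(\omega,w',x-1)=\bigoplus_{1\le k\le rp}(R/\sigma^k(\mathfrak m_0))e_k$ with indices of $e$ and $w'$ read cyclically mod $rp$: $Xe_k=\sigma(t')e_{k+1}$ if $w'_k=1$, $e_{k+1}$ if $w'_k=x$, $0$ if $w'_k\in\{y,0\}$; $Ye_k=e_{k-1}$ if $w'_{k-1}\in\{1,y\}$, $0$ if $w'_{k-1}\in\{x,0\}$. In all cases $X(rv)=\sigma(r)Xv$, $Y(rv)=\sigma^{-1}(r)Yv$. The set $\{0,1,x,y\}$ is a commutative monoid under $a\cdot a=a$, $a\cdot0=0$, $a\cdot1=a$, $x\cdot y=0$. *)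

(* Defs.v *)
From HB Require Import structures.
From mathcomp Require Import all_boot all_order all_algebra.
From mathcomp Require Import generic_quotient ring_quotient boolp.

Set Implicit Arguments.
Unset Strict Implicit.
Unset Printing Implicit Defensive.

Import GRing.Theory.
Local Open Scope ring_scope.
Local Open Scope quotient_scope.

Record ringAut (R : comNzRingType) := RingAut {
  aut_fun :> {rmorphism R -> R};
  aut_inv : {rmorphism R -> R};
  aut_funK : cancel aut_fun aut_inv;
  aut_invK : cancel aut_inv aut_fun
}.

(* [idealr R] is the library's type of proper ideals. *)
Record maxSpec (R : comNzRingType) := MaxSpec {
  ms_ideal :> idealr R;
  ms_maximal : forall J : idealr R,
    {subset ms_ideal <= J} -> {subset J <= ms_ideal}
}.

Section MaxSpecTheory.
Variable R : comNzRingType.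
Implicit Type m : maxSpec R.

(* If u is not in m, the ideal m + R u contains 1. *)
Lemma maxSpec_bezout m u : u \notin m -> exists a, 1 - a * u \in m.
Proof.
move=> um.
pose S : pred R := fun v => `[< exists a, v - a * u \in m >].
have SE v : (v \in S) = `[< exists a, v - a * u \in m >] by [].
case: (boolP (1 \in S)) => [|nS]; first by rewrite SE => /asboolP.
have S_id : idealr_closed S.
  split=> [|//|a x y].
    by rewrite SE; apply/asboolP; exists 0; rewrite mul0r subr0 rpred0.
  rewrite !SE => /asboolP[b bx] /asboolP[c cy]; apply/asboolP.
  exists (a * b + c).
  have -> : a * x + y - (a * b + c) * u = a * (x - b * u) + (y - c * u).
    by rewrite mulrDl mulrBr mulrA opprD addrACA.
  by rewrite rpredD // idealMr.
pose J := HB.pack_for (idealr R) S (isIdealr.Build R S S_id).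
have sub : {subset m <= J}.
  move=> x xm; rewrite [_ \in _]SE; apply/asboolP; exists 0.
  by rewrite mul0r subr0.
have uJ : u \in J.
  by rewrite [_ \in _]SE; apply/asboolP; exists 1; rewrite mul1r subrr rpred0.
by move: (ms_maximal sub uJ); rewrite (negPf um).
Qed.

Lemma maxSpec_prime m u v : (u * v \in m) = (u \in m) || (v \in m).
Proof.
apply/idP/orP => [uvm|[um|vm]]; last by rewrite idealMr.
  case: (boolP (u \in m)) => [|/maxSpec_bezout[a am]]; [by left|right].
  have -> : v = v * (1 - a * u) + a * (u * v).
    by rewrite mulrBr mulr1 (mulrC v) mulrA subrK.
  by rewrite rpredD // idealMr.
by rewrite mulrC idealMr.
Qed.

End MaxSpecTheory.

Section SpecAction.
Variables (R : comNzRingType) (sigma : ringAut R).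

(* The image sigma(I), written as the preimage of I under sigma^-1. *)
Definition aut_img (I : idealr R) : pred R :=
  fun s => aut_inv sigma s \in I.

Lemma mem_aut_img (I : idealr R) s : (s \in aut_img I) = (aut_inv sigma s \in I).
Proof. by []. Qed.

Lemma aut_img_closed (I : idealr R) : idealr_closed (aut_img I).
Proof.
split=> [||a x y]; rewrite !mem_aut_img.
- by rewrite rmorph0 rpred0.
- by rewrite rmorph1 idealr1.
- by move=> xI yI; rewrite rmorphD rmorphM rpredD // idealMr.
Qed.

HB.instance Definition _ (I : idealr R) :=
  isIdealr.Build R (aut_img I) (aut_img_closed I).

Definition aut_pre (I : idealr R) : pred R := fun s => sigma s \in I.

Lemma mem_aut_pre (I : idealr R) s : (s \in aut_pre I) = (sigma s \in I).
Proof. by []. Qed.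

Lemma aut_pre_closed (I : idealr R) : idealr_closed (aut_pre I).
Proof.
split=> [||a x y]; rewrite !mem_aut_pre.
- by rewrite rmorph0 rpred0.
- by rewrite rmorph1 idealr1.
- by move=> xI yI; rewrite rmorphD rmorphM rpredD // idealMr.
Qed.

HB.instance Definition _ (I : idealr R) :=
  isIdealr.Build R (aut_pre I) (aut_pre_closed I).

Lemma aut_img_maximal (m : maxSpec R) (J : idealr R) :
  {subset aut_img m <= J} -> {subset J <= aut_img m}.
Proof.
move=> sub s sJ; apply: (ms_maximal (m := m) (J := aut_pre J)).
  move=> x xm; rewrite mem_aut_pre; apply: sub.
  by rewrite mem_aut_img aut_funK.
by rewrite mem_aut_pre aut_invK.
Qed.

Definition spec_act (m : maxSpec R) : maxSpec R :=
  @MaxSpec R (aut_img m) (@aut_img_maximal m).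

(* sigma^k(m) *)
Definition spec_iter (k : nat) (m : maxSpec R) : maxSpec R :=
  iter k spec_act m.

Lemma mem_spec_iterS k m u : (sigma u \in spec_iter k.+1 m) = (u \in spec_iter k m).
Proof. by rewrite [LHS]mem_aut_img aut_funK. Qed.

Lemma mem_spec_iterSV k m u :
  (aut_inv sigma u \in spec_iter k m) = (u \in spec_iter k.+1 m).
Proof. by []. Qed.

Lemma mem_spec_iter k m u :
  (u \in spec_iter k m) = (iter k (aut_inv sigma) u \in m).
Proof. by elim: k u => // k IH u; rewrite -mem_spec_iterSV IH iterSr. Qed.

Lemma spec_iter_period p (sigma_p : forall u, iter p sigma u = u) q k m :
  spec_iter (k + q * p) m =i spec_iter k m.
Proof.
have pV u : iter p (aut_inv sigma) u = u.
  rewrite -{1}(sigma_p u); elim: p {sigma_p} => // p IH.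
  by rewrite iterSr iterS aut_funK.
move=> u; rewrite !mem_spec_iter iterD; congr (iter k _ _ \in m).
by elim: q => // q IH; rewrite mulSn iterD pV.
Qed.

End SpecAction.

Section DirectSum.
Variables (A : pzRingType) (I : finType) (V : I -> lmodType A).

(* I is finite, so the direct sum is the product. *)
Definition dsum : Type := {dffun forall i : I, V i}.
HB.instance Definition _ := Choice.copy dsum {dffun forall i : I, V i}.

Definition dsum_fun (u : dsum) (i : I) : V i :=
  (u : {dffun forall i : I, V i}) i.
Coercion dsum_fun : dsum >-> Funclass.

Definition mkdsum (f : forall i, V i) : dsum := finfun f.

Lemma mkdsumE f i : mkdsum f i = f i. Proof. exact: ffunE. Qed.

Lemma dsumP (u v : dsum) : (forall i, u i = v i) -> u = v.
Proof. by move=> uv; apply/ffunP. Qed.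

Definition dsum_zero : dsum := mkdsum (fun=> 0).
Definition dsum_opp (u : dsum) : dsum := mkdsum (fun i => - u i).
Definition dsum_add (u v : dsum) : dsum := mkdsum (fun i => u i + v i).
Definition dsum_scale (a : A) (u : dsum) : dsum := mkdsum (fun i => a *: u i).

Lemma dsum_addA : associative dsum_add.
Proof. by move=> u v w; apply: dsumP => i; rewrite !mkdsumE addrA. Qed.
Lemma dsum_addC : commutative dsum_add.
Proof. by move=> u v; apply: dsumP => i; rewrite !mkdsumE addrC. Qed.
Lemma dsum_add0 : left_id dsum_zero dsum_add.
Proof. by move=> u; apply: dsumP => i; rewrite !mkdsumE add0r. Qed.
Lemma dsum_addN : left_inverse dsum_zero dsum_opp dsum_add.
Proof. by move=> u; apply: dsumP => i; rewrite !mkdsumE addNr. Qed.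

HB.instance Definition _ :=
  GRing.isZmodule.Build dsum dsum_addA dsum_addC dsum_add0 dsum_addN.

Lemma dsum_scaleA a b u : dsum_scale a (dsum_scale b u) = dsum_scale (a * b) u.
Proof. by apply: dsumP => i; rewrite !mkdsumE scalerA. Qed.
Lemma dsum_scale1 : left_id 1 dsum_scale.
Proof. by move=> u; apply: dsumP => i; rewrite !mkdsumE scale1r. Qed.
Lemma dsum_scaleDr : right_distributive dsum_scale +%R.
Proof. by move=> a u v; apply: dsumP => i; rewrite !mkdsumE scalerDr. Qed.
Lemma dsum_scaleDl u : {morph dsum_scale^~ u : a b / a + b}.
Proof. by move=> a b; apply: dsumP => i; rewrite !mkdsumE scalerDl. Qed.

HB.instance Definition _ := GRing.Zmodule_isLmodule.Build A dsum
  dsum_scaleA dsum_scale1 dsum_scaleDr dsum_scaleDl.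

Lemma dsum0E i : dsum_fun 0 i = 0. Proof. exact: mkdsumE. Qed.
Lemma dsumDE (u v : dsum) i : dsum_fun (u + v) i = u i + v i. Proof. exact: mkdsumE. Qed.
Lemma dsumZE a (u : dsum) i : dsum_fun (a *: u) i = a *: u i. Proof. exact: mkdsumE. Qed.
Lemma dsum_sumE (J : Type) (s : seq J) (P : pred J) (F : J -> dsum) i :
  dsum_fun (\sum_(j <- s | P j) F j) i = \sum_(j <- s | P j) F j i.
Proof.
exact: (big_morph (fun u : dsum => u i) (fun u v => dsumDE u v i) (dsum0E i)).
Qed.

End DirectSum.

Section QuotientModule.
Variables (R : comNzRingType) (I : idealr R).

Definition iquot : Type := {ideal_quot I}.
HB.instance Definition _ := GRing.ComNzRing.copy iquot {ideal_quot I}.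

Implicit Types (a b : R) (x y : iquot).

Definition ipi a : iquot := \pi_{ideal_quot I} a.
Definition irepr x : R := repr (x : {ideal_quot I}).

Lemma ireprK x : ipi (irepr x) = x. Proof. exact: reprK. Qed.
Lemma ipiD a b : ipi (a + b) = ipi a + ipi b.
Proof. exact: (rmorphD \pi_{ideal_quot I}). Qed.
Lemma ipiM a b : ipi (a * b) = ipi a * ipi b.
Proof. exact: (rmorphM \pi_{ideal_quot I}). Qed.
Lemma ipi1 : ipi 1 = 1. Proof. exact: (rmorph1 \pi_{ideal_quot I}). Qed.
Lemma ipi0 : ipi 0 = 0. Proof. exact: (rmorph0 \pi_{ideal_quot I}). Qed.
Lemma ipi_eq a b : ipi a = ipi b <-> a - b \in I.
Proof.
by rewrite Quotient.idealrBE; split => [ab|/eqP//]; apply/eqP.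
Qed.
Lemma ipi_eq0 a : ipi a = 0 <-> a \in I.
Proof. by rewrite -ipi0 ipi_eq subr0. Qed.

Definition iquot_scale a x : iquot := ipi a * x.

Lemma iquot_scaleA a b x : iquot_scale a (iquot_scale b x) = iquot_scale (a * b) x.
Proof. by rewrite /iquot_scale mulrA -ipiM. Qed.
Lemma iquot_scale1 : left_id 1 iquot_scale.
Proof. by move=> x; rewrite /iquot_scale ipi1 mul1r. Qed.
Lemma iquot_scaleDr : right_distributive iquot_scale +%R.
Proof. by move=> a x y; rewrite /iquot_scale mulrDr. Qed.
Lemma iquot_scaleDl x : {morph iquot_scale^~ x : a b / a + b}.
Proof. by move=> a b; rewrite /iquot_scale ipiD mulrDl. Qed.

HB.instance Definition _ := GRing.Zmodule_isLmodule.Build R iquot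
  iquot_scaleA iquot_scale1 iquot_scaleDr iquot_scaleDl.

Lemma iquot_scaleE a x : a *: x = ipi a * x. Proof. by []. Qed.

Lemma iquot_scale_repr x : irepr x *: (1 : iquot) = x.
Proof. by rewrite iquot_scaleE mulr1 ireprK. Qed.

End QuotientModule.

Inductive gwa_term (R : Type) :=
  | GConst of R
  | GX
  | GY
  | GOpp of gwa_term R
  | GAdd of gwa_term R & gwa_term R
  | GMul of gwa_term R & gwa_term R.
Arguments GX {R}.
Arguments GY {R}.

HB.instance Definition _ (R : Type) := gen_eqMixin (gwa_term R).
HB.instance Definition _ (R : Type) := gen_choiceMixin (gwa_term R).

Section GWA.
Variables (R : comNzRingType) (sigma : ringAut R) (t : R).

(* The least ring congruence for which [GConst] is a ring morphism and the
   defining relations of A(t) hold. *)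
Inductive gwa_eq : gwa_term R -> gwa_term R -> Prop :=
  | ge_refl a : gwa_eq a a
  | ge_sym a b : gwa_eq a b -> gwa_eq b a
  | ge_trans b a c : gwa_eq a b -> gwa_eq b c -> gwa_eq a c
  | ge_opp a b : gwa_eq a b -> gwa_eq (GOpp a) (GOpp b)
  | ge_add a b c d : gwa_eq a b -> gwa_eq c d -> gwa_eq (GAdd a c) (GAdd b d)
  | ge_mul a b c d : gwa_eq a b -> gwa_eq c d -> gwa_eq (GMul a c) (GMul b d)
  | ge_addA a b c : gwa_eq (GAdd a (GAdd b c)) (GAdd (GAdd a b) c)
  | ge_addC a b : gwa_eq (GAdd a b) (GAdd b a)
  | ge_add0 a : gwa_eq (GAdd (GConst 0) a) a
  | ge_addN a : gwa_eq (GAdd (GOpp a) a) (GConst 0)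
  | ge_mulA a b c : gwa_eq (GMul a (GMul b c)) (GMul (GMul a b) c)
  | ge_mul1l a : gwa_eq (GMul (GConst 1) a) a
  | ge_mul1r a : gwa_eq (GMul a (GConst 1)) a
  | ge_mulDl a b c : gwa_eq (GMul (GAdd a b) c) (GAdd (GMul a c) (GMul b c))
  | ge_mulDr a b c : gwa_eq (GMul a (GAdd b c)) (GAdd (GMul a b) (GMul a c))
  | ge_constD r s : gwa_eq (GConst (r + s)) (GAdd (GConst r) (GConst s))
  | ge_constM r s : gwa_eq (GConst (r * s)) (GMul (GConst r) (GConst s))
  | ge_Xr r : gwa_eq (GMul GX (GConst r)) (GMul (GConst (sigma r)) GX)
  | ge_Yr r : gwa_eq (GMul GY (GConst r)) (GMul (GConst (aut_inv sigma r)) GY)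
  | ge_YX : gwa_eq (GMul GY GX) (GConst t)
  | ge_XY : gwa_eq (GMul GX GY) (GConst (sigma t)).

Definition gwa_rel (a b : gwa_term R) : bool := `[< gwa_eq a b >].

Lemma gwa_rel_equiv : equiv_class_of gwa_rel.
Proof.
split=> [a|a b|b a c].
- by apply/asboolP; exact: ge_refl.
- by apply/asboolP/asboolP; exact: ge_sym.
- by move=> /asboolP ab /asboolP bc; apply/asboolP; exact: ge_trans ab bc.
Qed.

Canonical gwa_rel_equivRel := EquivRelPack gwa_rel_equiv.

Definition gwa : Type := {eq_quot gwa_rel}.
HB.instance Definition _ := Choice.copy gwa {eq_quot gwa_rel}.

Definition gpi (a : gwa_term R) : gwa := \pi_{eq_quot gwa_rel} a.
Definition grepr (u : gwa) : gwa_term R := repr (u : {eq_quot gwa_rel}).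

Lemma greprK u : gpi (grepr u) = u. Proof. exact: reprK. Qed.

Lemma gpiP a b : gpi a = gpi b <-> gwa_eq a b.
Proof. by split=> [/eqmodP/asboolP//|ab]; apply/eqmodP/asboolP. Qed.

Lemma grepr_pi a : gwa_eq (grepr (gpi a)) a.
Proof. by apply/gpiP; rewrite greprK. Qed.

Definition gwa_opp (u : gwa) : gwa := gpi (GOpp (grepr u)).
Definition gwa_add (u v : gwa) : gwa := gpi (GAdd (grepr u) (grepr v)).
Definition gwa_mul (u v : gwa) : gwa := gpi (GMul (grepr u) (grepr v)).

Lemma gpi_opp a : gwa_opp (gpi a) = gpi (GOpp a).
Proof. by apply/gpiP; apply: ge_opp; exact: grepr_pi. Qed.
Lemma gpi_add a b : gwa_add (gpi a) (gpi b) = gpi (GAdd a b).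
Proof. by apply/gpiP; apply: ge_add; exact: grepr_pi. Qed.
Lemma gpi_mul a b : gwa_mul (gpi a) (gpi b) = gpi (GMul a b).
Proof. by apply/gpiP; apply: ge_mul; exact: grepr_pi. Qed.

Let gpiE := (gpi_opp, gpi_add, gpi_mul).

Lemma gwa_addA : associative gwa_add.
Proof.
move=> u v w; rewrite -(greprK u) -(greprK v) -(greprK w) !gpiE.
by apply/gpiP; constructor.
Qed.
Lemma gwa_addC : commutative gwa_add.
Proof.
by move=> u v; rewrite -(greprK u) -(greprK v) !gpiE; apply/gpiP; constructor.
Qed.
Lemma gwa_add0 : left_id (gpi (GConst 0)) gwa_add.
Proof. by move=> u; rewrite -(greprK u) !gpiE; apply/gpiP; constructor. Qed.
Lemma gwa_addN : left_inverse (gpi (GConst 0)) gwa_opp gwa_add.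
Proof. by move=> u; rewrite -(greprK u) !gpiE; apply/gpiP; constructor. Qed.

HB.instance Definition _ :=
  GRing.isZmodule.Build gwa gwa_addA gwa_addC gwa_add0 gwa_addN.

Lemma gwa_mulA : associative gwa_mul.
Proof.
move=> u v w; rewrite -(greprK u) -(greprK v) -(greprK w) !gpiE.
by apply/gpiP; constructor.
Qed.
Lemma gwa_mul1l : left_id (gpi (GConst 1)) gwa_mul.
Proof. by move=> u; rewrite -(greprK u) !gpiE; apply/gpiP; constructor. Qed.
Lemma gwa_mul1r : right_id (gpi (GConst 1)) gwa_mul.
Proof. by move=> u; rewrite -(greprK u) !gpiE; apply/gpiP; constructor. Qed.
Lemma gwa_mulDl : left_distributive gwa_mul +%R.
Proof.
move=> u v w; rewrite -(greprK u) -(greprK v) -(greprK w).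
by rewrite /GRing.add /= !gpiE; apply/gpiP; constructor.
Qed.
Lemma gwa_mulDr : right_distributive gwa_mul +%R.
Proof.
move=> u v w; rewrite -(greprK u) -(greprK v) -(greprK w).
by rewrite /GRing.add /= !gpiE; apply/gpiP; constructor.
Qed.

HB.instance Definition _ := GRing.Zmodule_isPzRing.Build gwa
  gwa_mulA gwa_mul1l gwa_mul1r gwa_mulDl gwa_mulDr.

Definition gwa_const (r : R) : gwa := gpi (GConst r).
Definition gwa_X : gwa := gpi GX.
Definition gwa_Y : gwa := gpi GY.

Lemma gpiN a : gpi (GOpp a) = - gpi a. Proof. by rewrite -gpi_opp. Qed.
Lemma gpiD a b : gpi (GAdd a b) = gpi a + gpi b. Proof. by rewrite -gpi_add. Qed.
Lemma gpiM a b : gpi (GMul a b) = gpi a * gpi b. Proof. by rewrite -gpi_mul. Qed.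

Lemma gwa_const1 : gwa_const 1 = 1. Proof. by []. Qed.
Lemma gwa_constD : {morph gwa_const : r s / r + s}.
Proof. by move=> r s; rewrite /gwa_const -gpiD; apply/gpiP; constructor. Qed.
Lemma gwa_constM : {morph gwa_const : r s / r * s}.
Proof. by move=> r s; rewrite /gwa_const -gpiM; apply/gpiP; constructor. Qed.
Lemma gwa_Xr r : gwa_X * gwa_const r = gwa_const (sigma r) * gwa_X.
Proof. by rewrite /gwa_const -!gpiM; apply/gpiP; constructor. Qed.
Lemma gwa_Yr r : gwa_Y * gwa_const r = gwa_const (aut_inv sigma r) * gwa_Y.
Proof. by rewrite /gwa_const -!gpiM; apply/gpiP; constructor. Qed.
Lemma gwa_YX : gwa_Y * gwa_X = gwa_const t.
Proof. by rewrite /gwa_const -!gpiM; apply/gpiP; constructor. Qed.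
Lemma gwa_XY : gwa_X * gwa_Y = gwa_const (sigma t).
Proof. by rewrite /gwa_const -!gpiM; apply/gpiP; constructor. Qed.

Lemma gwa_ind (P : gwa -> Prop) :
  (forall r, P (gwa_const r)) -> P gwa_X -> P gwa_Y ->
  (forall u, P u -> P (- u)) ->
  (forall u v, P u -> P v -> P (u + v)) ->
  (forall u v, P u -> P v -> P (u * v)) -> forall u, P u.
Proof.
move=> PC PX PY PN PD PM u; rewrite -(greprK u).
elim: (grepr u) => [r|||a Pa|a Pa b Pb|a Pa b Pb].
- exact: PC.
- exact: PX.
- exact: PY.
- by rewrite gpiN; exact: PN.
- by rewrite gpiD; exact: PD.
- by rewrite gpiM; exact: PM.
Qed.

End GWA.

Section GWAModule.
Variables (R : comNzRingType) (sigma : ringAut R) (t : R).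

Record gwa_ops (M : lmodType R) := GwaOps {
  opX : M -> M;
  opY : M -> M;
  opXD : {morph opX : u v / u + v};
  opYD : {morph opY : u v / u + v};
  opXZ : forall r u, opX (r *: u) = sigma r *: opX u;
  opYZ : forall r u, opY (r *: u) = aut_inv sigma r *: opY u;
  opYX : forall u, opY (opX u) = t *: u;
  opXY : forall u, opX (opY u) = sigma t *: u
}.

Section FromOps.
Variables (M : lmodType R) (O : gwa_ops M).

Fixpoint geval (a : gwa_term R) (u : M) : M :=
  match a with
  | GConst r => r *: u
  | GX => opX O u
  | GY => opY O u
  | GOpp b => - geval b u
  | GAdd b c => geval b u + geval c u
  | GMul b c => geval b (geval c u)
  end.

Lemma gevalD a : {morph geval a : u v / u + v}.
Proof.
elim: a => [r|||b IHb|b IHb c IHc|b IHb c IHc] u v /=.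
- exact: scalerDr.
- exact: opXD.
- exact: opYD.
- by rewrite IHb opprD.
- by rewrite IHb IHc addrACA.
- by rewrite IHc IHb.
Qed.

Lemma geval_eq a b : gwa_eq sigma t a b -> geval a =1 geval b.
Proof.
elim=> {a b} /=.
- by [].
- by move=> a b _ IH u; rewrite IH.
- by move=> b a c _ IH1 _ IH2 u; rewrite IH1.
- by move=> a b _ IH u; rewrite IH.
- by move=> a b c d _ IH1 _ IH2 u; rewrite IH1 IH2.
- by move=> a b c d _ IH1 _ IH2 u; rewrite IH1 IH2.
- by move=> a b c u; rewrite addrA.
- by move=> a b u; rewrite addrC.
- by move=> a u; rewrite scale0r add0r.
- by move=> a u; rewrite addNr scale0r.
- by [].
- by move=> a u; rewrite scale1r.
- by move=> a u; rewrite scale1r.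
- by [].
- by move=> a b c u; rewrite gevalD.
- by move=> r s u; rewrite scalerDl.
- by move=> r s u; rewrite scalerA.
- by move=> r u; rewrite opXZ.
- by move=> r u; rewrite opYZ.
- by move=> u; rewrite opYX.
- by move=> u; rewrite opXY.
Qed.

Definition gwa_mod_of (_ : gwa_ops M) : Type := M.
Local Notation gwa_mod := (gwa_mod_of O).
HB.instance Definition _ := GRing.Zmodule.copy gwa_mod M.

Definition gwa_mod_scale (a : gwa sigma t) (u : gwa_mod) : gwa_mod :=
  geval (grepr a) u.

Lemma gwa_mod_scale_pi a u : gwa_mod_scale (gpi sigma t a) u = geval a u.
Proof. by apply: geval_eq; exact: grepr_pi. Qed.

Lemma gwa_mod_scaleA a b u :
  gwa_mod_scale a (gwa_mod_scale b u) = gwa_mod_scale (a * b) u.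
Proof. by rewrite -(greprK a) -(greprK b) -gpiM !gwa_mod_scale_pi. Qed.
Lemma gwa_mod_scale1 : left_id 1 gwa_mod_scale.
Proof. by move=> u; rewrite -gwa_const1 gwa_mod_scale_pi /= scale1r. Qed.
Lemma gwa_mod_scaleDr : right_distributive gwa_mod_scale +%R.
Proof. by move=> a u v; exact: gevalD. Qed.
Lemma gwa_mod_scaleDl u : {morph gwa_mod_scale^~ u : a b / a + b}.
Proof.
by move=> a b; rewrite -(greprK a) -(greprK b) -gpiD !gwa_mod_scale_pi.
Qed.

HB.instance Definition _ := GRing.Zmodule_isLmodule.Build (gwa sigma t) gwa_mod
  gwa_mod_scaleA gwa_mod_scale1 gwa_mod_scaleDr gwa_mod_scaleDl.

Lemma gwa_mod_constE r (u : gwa_mod) : gwa_const sigma t r *: u = (r *: (u : M)).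
Proof. exact: gwa_mod_scale_pi. Qed.
Lemma gwa_mod_XE (u : gwa_mod) : gwa_X sigma t *: u = opX O u.
Proof. exact: gwa_mod_scale_pi. Qed.
Lemma gwa_mod_YE (u : gwa_mod) : gwa_Y sigma t *: u = opY O u.
Proof. exact: gwa_mod_scale_pi. Qed.

End FromOps.

Section Restriction.
Variable M : lmodType (gwa sigma t).

Definition res_mod : Type := M.
HB.instance Definition _ := GRing.Zmodule.copy res_mod M.

Definition res_scale (r : R) (u : res_mod) : res_mod :=
  gwa_const sigma t r *: (u : M).

Lemma res_scaleA r s u : res_scale r (res_scale s u) = res_scale (r * s) u.
Proof. by rewrite /res_scale scalerA -gwa_constM. Qed.
Lemma res_scale1 : left_id 1 res_scale.
Proof. by move=> u; rewrite /res_scale gwa_const1 scale1r. Qed.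
Lemma res_scaleDr : right_distributive res_scale +%R.
Proof. by move=> r u v; rewrite /res_scale -scalerDr. Qed.
Lemma res_scaleDl u : {morph res_scale^~ u : r s / r + s}.
Proof. by move=> r s; rewrite /res_scale gwa_constD scalerDl. Qed.

HB.instance Definition _ := GRing.Zmodule_isLmodule.Build R res_mod
  res_scaleA res_scale1 res_scaleDr res_scaleDl.

Lemma res_scaleE r (u : res_mod) : r *: u = gwa_const sigma t r *: (u : M).
Proof. by []. Qed.

End Restriction.

End GWAModule.

Inductive tens_term (M N : Type) :=
  | TZero
  | TPure of M & N
  | TOpp of tens_term M N
  | TAdd of tens_term M N & tens_term M N.
Arguments TZero {M N}.

HB.instance Definition _ (M N : Type) := gen_eqMixin (tens_term M N).
HB.instance Definition _ (M N : Type) := gen_choiceMixin (tens_term M N).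

Section Tensor.
Variables (R : comNzRingType) (M N : lmodType R).

(* The least additive congruence making [TPure] biadditive and R-balanced. *)
Inductive tens_eq : tens_term M N -> tens_term M N -> Prop :=
  | te_refl a : tens_eq a a
  | te_sym a b : tens_eq a b -> tens_eq b a
  | te_trans b a c : tens_eq a b -> tens_eq b c -> tens_eq a c
  | te_opp a b : tens_eq a b -> tens_eq (TOpp a) (TOpp b)
  | te_add a b c d : tens_eq a b -> tens_eq c d -> tens_eq (TAdd a c) (TAdd b d)
  | te_addA a b c : tens_eq (TAdd a (TAdd b c)) (TAdd (TAdd a b) c)
  | te_addC a b : tens_eq (TAdd a b) (TAdd b a)
  | te_add0 a : tens_eq (TAdd TZero a) a
  | te_addN a : tens_eq (TAdd (TOpp a) a) TZero
  | te_pureDl u v w :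
      tens_eq (TPure (u + v) w) (TAdd (TPure u w) (TPure v w))
  | te_pureDr u v w :
      tens_eq (TPure u (v + w)) (TAdd (TPure u v) (TPure u w))
  | te_pureZ r u v : tens_eq (TPure (r *: u) v) (TPure u (r *: v)).

Definition tens_rel (a b : tens_term M N) : bool := `[< tens_eq a b >].

Lemma tens_rel_equiv : equiv_class_of tens_rel.
Proof.
split=> [a|a b|b a c].
- by apply/asboolP; exact: te_refl.
- by apply/asboolP/asboolP; exact: te_sym.
- by move=> /asboolP ab /asboolP bc; apply/asboolP; exact: te_trans ab bc.
Qed.

Canonical tens_rel_equivRel := EquivRelPack tens_rel_equiv.

Definition tens : Type := {eq_quot tens_rel}.
HB.instance Definition _ := Choice.copy tens {eq_quot tens_rel}.

Definition tpi (a : tens_term M N) : tens := \pi_{eq_quot tens_rel} a.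
Definition trepr (u : tens) : tens_term M N := repr (u : {eq_quot tens_rel}).

Lemma treprK u : tpi (trepr u) = u. Proof. exact: reprK. Qed.

Lemma tpiP a b : tpi a = tpi b <-> tens_eq a b.
Proof. by split=> [/eqmodP/asboolP//|ab]; apply/eqmodP/asboolP. Qed.

Lemma trepr_pi a : tens_eq (trepr (tpi a)) a.
Proof. by apply/tpiP; rewrite treprK. Qed.

Definition tens_opp (u : tens) : tens := tpi (TOpp (trepr u)).
Definition tens_add (u v : tens) : tens := tpi (TAdd (trepr u) (trepr v)).

Lemma tpi_opp a : tens_opp (tpi a) = tpi (TOpp a).
Proof. by apply/tpiP; apply: te_opp; exact: trepr_pi. Qed.
Lemma tpi_add a b : tens_add (tpi a) (tpi b) = tpi (TAdd a b).
Proof. by apply/tpiP; apply: te_add; exact: trepr_pi. Qed.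

Let tpiE := (tpi_opp, tpi_add).

Lemma tens_addA : associative tens_add.
Proof.
move=> u v w; rewrite -(treprK u) -(treprK v) -(treprK w) !tpiE.
by apply/tpiP; constructor.
Qed.
Lemma tens_addC : commutative tens_add.
Proof.
by move=> u v; rewrite -(treprK u) -(treprK v) !tpiE; apply/tpiP; constructor.
Qed.
Lemma tens_add0 : left_id (tpi TZero) tens_add.
Proof. by move=> u; rewrite -(treprK u) !tpiE; apply/tpiP; constructor. Qed.
Lemma tens_addN : left_inverse (tpi TZero) tens_opp tens_add.
Proof. by move=> u; rewrite -(treprK u) !tpiE; apply/tpiP; constructor. Qed.

HB.instance Definition _ :=
  GRing.isZmodule.Build tens tens_addA tens_addC tens_add0 tens_addN.

Definition pure (u : M) (v : N) : tens := tpi (TPure u v).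

Lemma tpiN a : tpi (TOpp a) = - tpi a. Proof. by rewrite -tpi_opp. Qed.
Lemma tpiD a b : tpi (TAdd a b) = tpi a + tpi b. Proof. by rewrite -tpi_add. Qed.

Lemma pureDl u v w : pure (u + v) w = pure u w + pure v w.
Proof. by rewrite /pure -tpiD; apply/tpiP; constructor. Qed.
Lemma pureDr u v w : pure u (v + w) = pure u v + pure u w.
Proof. by rewrite /pure -tpiD; apply/tpiP; constructor. Qed.
Lemma pureZ r u v : pure (r *: u) v = pure u (r *: v).
Proof. by apply/tpiP; constructor. Qed.

Lemma tens_ind (P : tens -> Prop) :
  P 0 -> (forall u v, P (pure u v)) -> (forall x, P x -> P (- x)) ->
  (forall x y, P x -> P y -> P (x + y)) -> forall x, P x.
Proof.
move=> P0 Ppure PN PD x; rewrite -(treprK x).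
elim: (trepr x) => [|u v|a Pa|a Pa b Pb].
- exact: P0.
- exact: Ppure.
- by rewrite tpiN; exact: PN.
- by rewrite tpiD; exact: PD.
Qed.

Section Lift.
Variables (Z : zmodType) (f : M -> N -> Z).
Hypothesis fDl : forall u v w, f (u + v) w = f u w + f v w.
Hypothesis fDr : forall u v w, f u (v + w) = f u v + f u w.
Hypothesis fZ : forall r u v, f (r *: u) v = f u (r *: v).

Fixpoint teval (a : tens_term M N) : Z :=
  match a with
  | TZero => 0
  | TPure u v => f u v
  | TOpp b => - teval b
  | TAdd b c => teval b + teval c
  end.

Lemma teval_eq a b : tens_eq a b -> teval a = teval b.
Proof.
elim=> {a b} //=.
- by move=> b a c _ -> _ ->.
- by move=> a b _ ->.
- by move=> a b c d _ -> _ ->.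
- by move=> a b c; rewrite addrA.
- by move=> a b; rewrite addrC.
- by move=> a; rewrite add0r.
- by move=> a; rewrite addNr.
Qed.

Definition tens_lift (x : tens) : Z := teval (trepr x).

Lemma tens_lift_pi a : tens_lift (tpi a) = teval a.
Proof. by apply: teval_eq; exact: trepr_pi. Qed.
Lemma tens_lift_pure u v : tens_lift (pure u v) = f u v.
Proof. exact: tens_lift_pi. Qed.
Lemma tens_liftD : {morph tens_lift : x y / x + y}.
Proof. by move=> x y; rewrite -(treprK x) -(treprK y) -tpiD !tens_lift_pi. Qed.

End Lift.

Lemma additive_morph0 (Z Z' : zmodType) (f : Z -> Z') :
  {morph f : x y / x + y} -> f 0 = 0.
Proof. by move=> fD; apply: (addrI (f 0)); rewrite -fD !addr0. Qed.

Lemma additive_morphN (Z Z' : zmodType) (f : Z -> Z') :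
  {morph f : x y / x + y} -> {morph f : x / - x}.
Proof.
by move=> fD x; apply: (addrI (f x)); rewrite -fD !subrr (additive_morph0 fD).
Qed.

Lemma tens_ext (Z : zmodType) (f g : tens -> Z) :
  {morph f : x y / x + y} -> {morph g : x y / x + y} ->
  (forall u v, f (pure u v) = g (pure u v)) -> f =1 g.
Proof.
move=> fD gD fg; apply: tens_ind => // [|x fx|x y fx fy].
- by rewrite (additive_morph0 fD) (additive_morph0 gD).
- by rewrite (additive_morphN fD) (additive_morphN gD) fx.
- by rewrite fD gD fx fy.
Qed.

Definition tens_scale (r : R) : tens -> tens :=
  tens_lift (fun u v => pure (r *: u) v).

Lemma tens_scale_pure r u v : tens_scale r (pure u v) = pure (r *: u) v.
Proof.
apply: tens_lift_pure => [u1 u2 v1|u1 v1 v2|s u1 v1].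
- by rewrite scalerDr pureDl.
- by rewrite pureDr.
- by rewrite scalerA mulrC -scalerA pureZ.
Qed.

Lemma tens_scaleDr : right_distributive tens_scale +%R.
Proof.
move=> r; apply: tens_liftD => [u1 u2 v1|u1 v1 v2|s u1 v1].
- by rewrite scalerDr pureDl.
- by rewrite pureDr.
- by rewrite scalerA mulrC -scalerA pureZ.
Qed.

Lemma tens_scaleA r s x : tens_scale r (tens_scale s x) = tens_scale (r * s) x.
Proof.
move: x; apply: tens_ext => [x y|x y|u v]; rewrite ?tens_scaleDr //.
by rewrite !tens_scale_pure scalerA.
Qed.
Lemma tens_scale1 : left_id 1 tens_scale.
Proof.
apply: (tens_ext (g := id)) => [x y|//|u v]; first by rewrite tens_scaleDr.
by rewrite tens_scale_pure scale1r.
Qed.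
Lemma tens_scaleDl x : {morph tens_scale^~ x : r s / r + s}.
Proof.
move=> r s; move: x; apply: tens_ext => [x y|x y|u v].
- exact: tens_scaleDr.
- by rewrite !tens_scaleDr addrACA.
- by rewrite !tens_scale_pure scalerDl pureDl.
Qed.

HB.instance Definition _ := GRing.Zmodule_isLmodule.Build R tens
  tens_scaleA tens_scale1 tens_scaleDr tens_scaleDl.

Lemma scale_pure r u v : r *: pure u v = pure (r *: u) v.
Proof. exact: tens_scale_pure. Qed.

End Tensor.

Section GWATensor.
Variables (R : comNzRingType) (sigma : ringAut R) (t t' : R).
Variables (M : lmodType (gwa sigma t)) (N : lmodType (gwa sigma t')).

Local Notation T := (tens (res_mod M) (res_mod N)).

Definition gtX : T -> T :=
  tens_lift (fun (u : res_mod M) (v : res_mod N) =>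
    pure (gwa_X sigma t *: (u : M) : res_mod M)
         (gwa_X sigma t' *: (v : N) : res_mod N)).

Definition gtY : T -> T :=
  tens_lift (fun (u : res_mod M) (v : res_mod N) =>
    pure (gwa_Y sigma t *: (u : M) : res_mod M)
         (gwa_Y sigma t' *: (v : N) : res_mod N)).

Lemma res_scalerD s (P : lmodType (gwa sigma s)) a (u v : res_mod P) :
  (a *: ((u + v : res_mod P) : P) : res_mod P)
    = (a *: (u : P) : res_mod P) + (a *: (v : P) : res_mod P).
Proof. exact: (scalerDr a (u : P) (v : P)). Qed.

Lemma res_XZ s (P : lmodType (gwa sigma s)) r (u : res_mod P) :
  (gwa_X sigma s *: ((r *: u : res_mod P) : P) : res_mod P)
    = sigma r *: (gwa_X sigma s *: (u : P) : res_mod P).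
Proof. by rewrite !res_scaleE !scalerA gwa_Xr. Qed.

Lemma res_YZ s (P : lmodType (gwa sigma s)) r (u : res_mod P) :
  (gwa_Y sigma s *: ((r *: u : res_mod P) : P) : res_mod P)
    = aut_inv sigma r *: (gwa_Y sigma s *: (u : P) : res_mod P).
Proof. by rewrite !res_scaleE !scalerA gwa_Yr. Qed.

Lemma gtX_pure u v : gtX (pure u v) =
  pure (gwa_X sigma t *: (u : M) : res_mod M)
       (gwa_X sigma t' *: (v : N) : res_mod N).
Proof.
apply: tens_lift_pure => [u1 u2 v1|u1 v1 v2|s u1 v1].
- by rewrite res_scalerD pureDl.
- by rewrite res_scalerD pureDr.
- by rewrite !res_XZ pureZ.
Qed.

Lemma gtY_pure u v : gtY (pure u v) =
  pure (gwa_Y sigma t *: (u : M) : res_mod M)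
       (gwa_Y sigma t' *: (v : N) : res_mod N).
Proof.
apply: tens_lift_pure => [u1 u2 v1|u1 v1 v2|s u1 v1].
- by rewrite res_scalerD pureDl.
- by rewrite res_scalerD pureDr.
- by rewrite !res_YZ pureZ.
Qed.

Lemma gtXD : {morph gtX : x y / x + y}.
Proof.
apply: tens_liftD => [u1 u2 v1|u1 v1 v2|s u1 v1].
- by rewrite res_scalerD pureDl.
- by rewrite res_scalerD pureDr.
- by rewrite !res_XZ pureZ.
Qed.

Lemma gtYD : {morph gtY : x y / x + y}.
Proof.
apply: tens_liftD => [u1 u2 v1|u1 v1 v2|s u1 v1].
- by rewrite res_scalerD pureDl.
- by rewrite res_scalerD pureDr.
- by rewrite !res_YZ pureZ.
Qed.

Lemma gtXZ r x : gtX (r *: x) = sigma r *: gtX x.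
Proof.
move: x; apply: tens_ext => [x y|x y|u v].
- by rewrite scalerDr gtXD.
- by rewrite gtXD scalerDr.
- by rewrite scale_pure !gtX_pure res_XZ scale_pure.
Qed.

Lemma gtYZ r x : gtY (r *: x) = aut_inv sigma r *: gtY x.
Proof.
move: x; apply: tens_ext => [x y|x y|u v].
- by rewrite scalerDr gtYD.
- by rewrite gtYD scalerDr.
- by rewrite scale_pure !gtY_pure res_YZ scale_pure.
Qed.

Lemma gtYX x : gtY (gtX x) = (t * t') *: x.
Proof.
move: x; apply: tens_ext => [x y|x y|u v].
- by rewrite gtXD gtYD.
- by rewrite scalerDr.
- rewrite gtX_pure gtY_pure !scalerA !gwa_YX -scalerA [t' *: _]scale_pure.
  by rewrite pureZ scale_pure.
Qed.

Lemma gtXY x : gtX (gtY x) = sigma (t * t') *: x.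
Proof.
move: x; apply: tens_ext => [x y|x y|u v].
- by rewrite gtYD gtXD.
- by rewrite scalerDr.
- rewrite gtY_pure gtX_pure !scalerA !gwa_XY rmorphM -scalerA.
  by rewrite [sigma t' *: _]scale_pure pureZ scale_pure.
Qed.

Definition gwa_tens_ops : gwa_ops sigma (t * t') T :=
  GwaOps gtXD gtYD gtXZ gtYZ gtYX gtXY.

Definition gwa_tens : lmodType (gwa sigma (t * t')) := gwa_mod_of gwa_tens_ops.

End GWATensor.

Inductive letter := One | Lx | Ly | Zero.

Definition eq_letter (a b : letter) : bool :=
  match a, b with
  | One, One | Lx, Lx | Ly, Ly | Zero, Zero => true
  | _, _ => false
  end.

Lemma eq_letterP : Equality.axiom eq_letter.
Proof. by move=> [] []; constructor. Qed.

HB.instance Definition _ := hasDecEq.Build letter eq_letterP.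

Definition letter_mul (a b : letter) : letter :=
  match a, b with
  | One, c | c, One => c
  | Lx, Lx => Lx
  | Ly, Ly => Ly
  | _, _ => Zero
  end.

Lemma letter_mulC : commutative letter_mul. Proof. by move=> [] []. Qed.
Lemma letter_mulA : associative letter_mul. Proof. by move=> [] [] []. Qed.
Lemma letter_mul_eq1 a b : (letter_mul a b == One) = (a == One) && (b == One).
Proof. by case: a; case: b. Qed.

(* The letter w_k of the indexed word w = w_j w_(j+1) ..., for
   j <= k < j + size w. *)
Definition wlet (j : nat) (w : seq letter) (k : nat) : letter :=
  nth One w (k - j).

(* The letter w_k of w = w_1 ... w_n, with k read modulo n. *)
Definition cyclet (n : nat) (w : n.-tuple letter) (k : nat) : letter :=
  nth One w ((k + n.-1) %% n).

Section Words.
Variables (R : comNzRingType) (sigma : ringAut R) (m0 : maxSpec R).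

(* sigma^k(m0) is in B^t, the set of elements of the orbit containing t. *)
Definition in_B (t : R) (k : nat) : bool := t \in spec_iter sigma k m0.

(* w = w_j w_(j+1) ... belongs to D^t. *)
Definition in_D (t : R) (j : nat) (w : seq letter) : Prop :=
  forall k, (j <= k < j + size w)%N -> (wlet j w k == One) = ~~ in_B t k.

(* The conditions under which V^t(omega, i, w), w = w_(i+1) ... w_(i+l),
   is defined. *)
Definition line_defined (p : nat) (t : R) (i l : nat) (w : l.-tuple letter) :=
  [/\ (i < p)%N, in_B t i, in_D t i.+1 w & in_B t (i + l).+1].

(* w^[j] *)
Definition word_prod (p i l : nat) (w : l.-tuple letter)
    (n : nat) (w' : n.-tuple letter) (j : nat) : l.-tuple letter :=
  [tuple letter_mul (wlet i.+1 w (i.+1 + a)) (cyclet w' (i.+1 + a + j * p))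
   | a < l].

Lemma in_BS t k : in_B (sigma t) k.+1 = in_B t k.
Proof. exact: mem_spec_iterS. Qed.

Lemma in_BM t t' k : in_B (t * t') k = in_B t k || in_B t' k.
Proof. exact: maxSpec_prime. Qed.

Section Periodic.
Variables (p : nat) (sigma_p : forall u, iter p sigma u = u).

Lemma in_B_period t q k : in_B t (k + q * p) = in_B t k.
Proof. exact: spec_iter_period. Qed.

Lemma in_D_cyclet t r (w : (r * p).-tuple letter) k :
  (0 < r * p)%N -> in_D t 1 w -> (cyclet w k == One) = ~~ in_B t k.
Proof.
move=> n0 wD; have := wD ((k + (r * p).-1) %% (r * p)).+1.
rewrite size_tuple add1n !ltnS ltn_pmod // /wlet subn1 /= => -> //.
congr (~~ _); rewrite -addn1.
set n := (r * p)%N in n0 *; set d := (k + n.-1)%N.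
have -> : in_B t k = in_B t (k + n) by rewrite in_B_period.
have -> : (k + n = d %% n + 1 + d %/ n * r * p)%N.
  by rewrite -mulnA addnAC [(_ %% _ + _)%N]addnC -divn_eq -addnA addn1 prednK.
by rewrite in_B_period.
Qed.

Lemma line_defined_prod t t' i l (w : l.-tuple letter)
    r (w' : (r * p).-tuple letter) (j : nat) :
  (0 < r)%N -> line_defined p t i w -> in_D t' 1 w' ->
  line_defined p (t * t') i (word_prod p i w w' j).
Proof.
move=> r0 [ip ti wD tl] w'D.
have n0 : (0 < r * p)%N by rewrite muln_gt0 r0 (leq_trans _ ip).
split; rewrite ?in_BM ?ti ?tl // => k.
rewrite size_tuple => /andP[ik kl].
have kl' : (k - i.+1 < l)%N by rewrite ltn_subLR.
rewrite {1}/wlet -[(k - i.+1)%N]/(nat_of_ord (Ordinal kl')) -tnth_nth tnth_mktuple /=.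
rewrite subnKC // letter_mul_eq1 in_BM negb_or wD ?size_tuple ?ik //.
by rewrite (in_D_cyclet _ n0 w'D) in_B_period.
Qed.

End Periodic.

End Words.

Section Semilinear.
Variables (R : comNzRingType) (n : nat) (m : 'I_n -> maxSpec R).

Definition resid (a : 'I_n) : lmodType R := iquot (m a).
Local Notation V := (dsum resid).

(* The vector whose components are 1 at the indices satisfying Q, else 0. *)
Definition delta (Q : pred 'I_n) : V :=
  mkdsum (V := resid) (fun a => (if Q a then 1 else 0 : iquot (m a))).

(* The f-semilinear map V -> V sending the a-th basis vector to g a:
   it maps r_a e_a to f(r_a) (g a). *)
Definition semilin (f : R -> R) (g : 'I_n -> V) (v : V) : V :=
  \sum_(a < n) f (irepr (v a)) *: g a.

Lemma deltaE Q a : delta Q a = (if Q a then 1 else 0 : iquot (m a)).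
Proof. exact: mkdsumE. Qed.

Lemma scale_delta_eq0 r (Q : pred 'I_n) :
  (forall a, Q a -> r \in m a) -> r *: delta Q = 0.
Proof.
move=> ra; apply: dsumP => b; rewrite dsumZE deltaE dsum0E /=.
case: ifP => [Qb|_]; last by rewrite scaler0.
by rewrite iquot_scaleE mulr1; apply/ipi_eq0; exact: ra.
Qed.

Lemma dsum_delta (v : V) :
  v = \sum_(a < n) irepr (v a) *: delta (pred1 a).
Proof.
apply: dsumP => b; rewrite dsum_sumE (bigD1 b) //= big1 => [|a ab].
  by rewrite addr0 dsumZE deltaE /= eqxx iquot_scale_repr.
by rewrite dsumZE deltaE /= eq_sym (negPf ab) scaler0.
Qed.

Section Ext.
Variables (f : {rmorphism R -> R}) (g : 'I_n -> V).
Hypothesis fg : forall a r, r \in m a -> f r *: g a = 0.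

Lemma semilin_term a r s : ipi (m a) r = ipi (m a) s -> f r *: g a = f s *: g a.
Proof.
move=> /ipi_eq/fg.
by rewrite rmorphB scalerBl => /eqP; rewrite subr_eq0 => /eqP.
Qed.

Lemma semilinD : {morph semilin f g : u v / u + v}.
Proof.
move=> u v; rewrite /semilin -big_split; apply: eq_bigr => a _ /=.
rewrite -scalerDl -rmorphD; apply: semilin_term.
by rewrite ireprK ipiD !ireprK dsumDE.
Qed.

Lemma semilinZ r u : semilin f g (r *: u) = f r *: semilin f g u.
Proof.
rewrite /semilin scaler_sumr; apply: eq_bigr => a _ /=.
rewrite scalerA -rmorphM; apply: semilin_term.
by rewrite ireprK ipiM ireprK dsumZE.
Qed.

Lemma semilin_delta a : semilin f g (delta (pred1 a)) = g a.
Proof.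
rewrite /semilin (bigD1 a) //= big1 => [|b ba].
  rewrite addr0 -[RHS]scale1r -[in RHS](rmorph1 f); apply: semilin_term.
  by rewrite ireprK deltaE /= eqxx ipi1.
rewrite -[RHS](scale0r (g b)) -[in RHS](rmorph0 f); apply: semilin_term.
by rewrite ireprK deltaE /= (negPf ba) ipi0.
Qed.

End Ext.

Lemma dsum_ext (h : V -> V) :
  {morph h : u v / u + v} -> (forall r u, h (r *: u) = r *: h u) ->
  forall c, (forall a, h (delta (pred1 a)) = c *: delta (pred1 a)) ->
  forall u, h u = c *: u.
Proof.
move=> hD hZ c hc u; rewrite {1}(dsum_delta u) {2}(dsum_delta u).
rewrite (big_morph h hD (additive_morph0 hD)) scaler_sumr.
by apply: eq_bigr => a _; rewrite hZ hc !scalerA mulrC.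
Qed.

End Semilinear.

Lemma delta_ext (R : comNzRingType) n (m : 'I_n -> maxSpec R) (Q Q' : pred 'I_n) :
  Q =1 Q' -> delta m Q = delta m Q'.
Proof. by move=> QQ'; apply: dsumP => a; rewrite !deltaE QQ'. Qed.

Section Line.
Variables (R : comNzRingType) (sigma : ringAut R) (m0 : maxSpec R).
Variables (p : nat) (t : R) (i l : nat) (w : l.-tuple letter).

(* The summand of index a is R / sigma^k(m0), with k = i + 1 + a. *)
Definition line_max (a : 'I_l.+1) : maxSpec R := spec_iter sigma (i.+1 + a) m0.

Definition line_space : lmodType R := dsum (resid line_max).

(* The basis vector e_k, for i + 1 <= k <= i + l + 1. *)
Definition line_e (k : nat) : line_space :=
  delta line_max (fun a => (i.+1 + a == k)%N).

Definition line_Xe (k : nat) : line_space :=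
  if k == (i + l).+1 then 0 else
  match wlet i.+1 w k with
  | One => sigma t *: line_e k.+1
  | Lx => line_e k.+1
  | Ly | Zero => 0
  end.

Definition line_Ye (k : nat) : line_space :=
  if k == i.+1 then 0 else
  match wlet i.+1 w k.-1 with
  | One | Ly => line_e k.-1
  | Lx | Zero => 0
  end.

Definition line_X : line_space -> line_space :=
  semilin sigma (fun a : 'I_l.+1 => line_Xe (i.+1 + a)).
Definition line_Y : line_space -> line_space :=
  semilin (aut_inv sigma) (fun a : 'I_l.+1 => line_Ye (i.+1 + a)).

Lemma line_e_eq0 k r : r \in spec_iter sigma k m0 -> r *: line_e k = 0.
Proof.
by move=> rk; apply: scale_delta_eq0 => a /eqP ak; rewrite /line_max ak.
Qed.

Lemma line_Xe_eq0 k r : r \in spec_iter sigma k m0 -> sigma r *: line_Xe k = 0.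
Proof.
move=> rk; have rk1 : sigma r *: line_e k.+1 = 0.
  by apply: line_e_eq0; rewrite mem_spec_iterS.
rewrite /line_Xe; case: eqP => _; first by rewrite scaler0.
by case: wlet; rewrite ?scaler0 // scalerA mulrC -scalerA rk1 scaler0.
Qed.

Lemma line_Ye_eq0 k r : (0 < k)%N ->
  r \in spec_iter sigma k m0 -> aut_inv sigma r *: line_Ye k = 0.
Proof.
case: k => // k _ rk; have rk1 : aut_inv sigma r *: line_e k = 0.
  by apply: line_e_eq0; rewrite mem_spec_iterSV.
by rewrite /line_Ye; case: eqP => _; last case: wlet; rewrite ?scaler0.
Qed.

Let Xkill (a : 'I_l.+1) r : r \in line_max a -> sigma r *: line_Xe (i.+1 + a) = 0.
Proof. exact: line_Xe_eq0. Qed.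
Let Ykill (a : 'I_l.+1) r :
  r \in line_max a -> aut_inv sigma r *: line_Ye (i.+1 + a) = 0.
Proof. exact: line_Ye_eq0. Qed.

Lemma line_eE (a : 'I_l.+1) : line_e (i.+1 + a) = delta line_max (pred1 a).
Proof. by apply: delta_ext => b /=; rewrite eqn_add2l. Qed.

Lemma line_idx k : (i < k <= (i + l).+1)%N -> exists a : 'I_l.+1, k = (i.+1 + a)%N.
Proof.
move=> /andP[ik kl]; have lt : (k - i.+1 < l.+1)%N.
  by rewrite ltn_subLR // addSn addnS !ltnS in kl *.
by exists (Ordinal lt); rewrite /= subnKC.
Qed.

Lemma line_X_e k : (i < k <= (i + l).+1)%N -> line_X (line_e k) = line_Xe k.
Proof.
by move=> /line_idx[a ->]; rewrite line_eE /line_X (semilin_delta Xkill).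
Qed.

Lemma line_Y_e k : (i < k <= (i + l).+1)%N -> line_Y (line_e k) = line_Ye k.
Proof.
by move=> /line_idx[a ->]; rewrite line_eE /line_Y (semilin_delta Ykill).
Qed.

Lemma line_XD : {morph line_X : u v / u + v}. Proof. exact: (semilinD Xkill). Qed.
Lemma line_YD : {morph line_Y : u v / u + v}. Proof. exact: (semilinD Ykill). Qed.
Lemma line_XZ r u : line_X (r *: u) = sigma r *: line_X u.
Proof. exact: (semilinZ Xkill). Qed.
Lemma line_YZ r u : line_Y (r *: u) = aut_inv sigma r *: line_Y u.
Proof. exact: (semilinZ Ykill). Qed.

Hypothesis ok : line_defined sigma m0 p t i w.

Let t_kill k : (i < k <= i + l)%N -> wlet i.+1 w k != One -> t *: line_e k = 0.
Proof.
case: ok => _ _ wD _ ikl; rewrite wD ?size_tuple // negbK.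
exact: line_e_eq0.
Qed.

Lemma line_YX u : line_Y (line_X u) = t *: u.
Proof.
move: u; apply: (dsum_ext (h := fun u => line_Y (line_X u))) => [u v|r u|a].
- by rewrite line_XD line_YD.
- by rewrite line_XZ line_YZ aut_funK.
rewrite -line_eE; set k := (i.+1 + a)%N.
have kl : (i < k <= (i + l).+1)%N.
  by rewrite leq_addr /= /k addSn ltnS leq_add2l -ltnS.
rewrite line_X_e // /line_Xe; case: ifP => [/eqP ->|kNl].
  rewrite (additive_morph0 line_YD); case: ok => _ _ _ tl.
  by rewrite line_e_eq0.
have kl1 : (i < k <= i + l)%N.
  by case/andP: kl => -> /=; rewrite leq_eqVlt kNl ltnS.
have kS : (i < k.+1 <= (i + l).+1)%N.
  by case/andP: kl1 => ik kl1; rewrite ltnS (ltnW ik) ltnS.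
have YS : line_Y (line_e k.+1) = match wlet i.+1 w k with
  | One | Ly => line_e k | Lx | Zero => 0 end.
  rewrite line_Y_e // /line_Ye /= eqSS.
  by case: eqP => // ki; move: kl1; rewrite ki ltnn.
have tk := t_kill kl1.
case E : (wlet i.+1 w k) in YS tk *.
- by rewrite line_YZ YS aut_funK.
- by rewrite YS tk.
- by rewrite (additive_morph0 line_YD) tk.
- by rewrite (additive_morph0 line_YD) tk.
Qed.

Lemma line_XY u : line_X (line_Y u) = sigma t *: u.
Proof.
move: u; apply: (dsum_ext (h := fun u => line_X (line_Y u))) => [u v|r u|a].
- by rewrite line_YD line_XD.
- by rewrite line_YZ line_XZ aut_invK.
rewrite -line_eE; set k := (i.+1 + a)%N.
have kl : (i < k <= (i + l).+1)%N.
  by rewrite leq_addr /= /k addSn ltnS leq_add2l -ltnS.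
rewrite line_Y_e // /line_Ye; case: ifP => [/eqP ->|kNi].
  rewrite (additive_morph0 line_XD); case: ok => _ ti _ _.
  by rewrite line_e_eq0 // mem_spec_iterS.
case: k kl kNi => // k kl; rewrite eqSS /= => kNi.
have kl1 : (i < k <= i + l)%N.
  by case/andP: kl => ik kl1; rewrite ltn_neqAle eq_sym kNi -ltnS ik.
have kl' : (i < k <= (i + l).+1)%N.
  by case/andP: kl1 => -> kl2; rewrite ltnW.
have XS : line_X (line_e k) = match wlet i.+1 w k with
  | One => sigma t *: line_e k.+1 | Lx => line_e k.+1 | Ly | Zero => 0 end.
  rewrite line_X_e // /line_Xe.
  by case: eqP => // kE; move: kl1; rewrite kE ltnn andbF.
have tk : wlet i.+1 w k != One -> sigma t *: line_e k.+1 = 0.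
  case: ok => _ _ wD _; rewrite wD ?size_tuple // negbK => tk.
  by rewrite line_e_eq0 // mem_spec_iterS.
case E : (wlet i.+1 w k) in XS tk *.
- by rewrite XS.
- by rewrite (additive_morph0 line_XD) tk.
- by rewrite XS tk.
- by rewrite (additive_morph0 line_XD) tk.
Qed.

Definition line_ops : gwa_ops sigma t line_space :=
  GwaOps line_XD line_YD line_XZ line_YZ line_YX line_XY.

Definition V_line : lmodType (gwa sigma t) := gwa_mod_of line_ops.

End Line.

Section Cycle.
Variables (R : comNzRingType) (sigma : ringAut R) (m0 : maxSpec R).
Variables (p : nat) (sigma_p : forall u, iter p sigma u = u).
Variables (t : R) (r : nat) (w : (r * p).-tuple letter).

Local Notation n := (r * p)%N.

(* The summand of index a is R / sigma^k(m0), with k = a + 1. *)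
Definition cycle_max (a : 'I_n) : maxSpec R := spec_iter sigma a.+1 m0.

Definition cycle_space : lmodType R := dsum (resid cycle_max).

(* The basis vector e_k, with k read modulo rp. *)
Definition cycle_e (k : nat) : cycle_space :=
  delta cycle_max (fun a => a.+1 == k %[mod n])%N.

Definition cycle_Xe (k : nat) : cycle_space :=
  match cyclet w k with
  | One => sigma t *: cycle_e k.+1
  | Lx => cycle_e k.+1
  | Ly | Zero => 0
  end.

(* For k >= 1. *)
Definition cycle_Ye (k : nat) : cycle_space :=
  match cyclet w k.-1 with
  | One | Ly => cycle_e k.-1
  | Lx | Zero => 0
  end.

Definition cycle_X : cycle_space -> cycle_space :=
  semilin sigma (fun a : 'I_n => cycle_Xe a.+1).
Definition cycle_Y : cycle_space -> cycle_space :=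
  semilin (aut_inv sigma) (fun a : 'I_n => cycle_Ye a.+1).

Lemma spec_iter_mod k k' :
  (k = k' %[mod n])%N -> spec_iter sigma k m0 =i spec_iter sigma k' m0.
Proof.
move=> kk' u; rewrite (divn_eq k n) (divn_eq k' n) !mulnA ![(_ * p + _)%N]addnC.
by rewrite !spec_iter_period // kk'.
Qed.

Lemma cycle_e_eq0 k s : s \in spec_iter sigma k m0 -> s *: cycle_e k = 0.
Proof.
move=> sk; apply: scale_delta_eq0 => a /eqP ak.
by rewrite /cycle_max (spec_iter_mod ak).
Qed.

Lemma cycle_Xe_eq0 k s : s \in spec_iter sigma k m0 -> sigma s *: cycle_Xe k = 0.
Proof.
move=> sk; have sk1 : sigma s *: cycle_e k.+1 = 0.
  by apply: cycle_e_eq0; rewrite mem_spec_iterS.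
rewrite /cycle_Xe; case: cyclet; rewrite ?scaler0 //.
by rewrite scalerA mulrC -scalerA sk1 scaler0.
Qed.

Lemma cycle_Ye_eq0 k s :
  s \in spec_iter sigma k.+1 m0 -> aut_inv sigma s *: cycle_Ye k.+1 = 0.
Proof.
move=> sk; have sk1 : aut_inv sigma s *: cycle_e k = 0.
  by apply: cycle_e_eq0; rewrite mem_spec_iterSV.
by rewrite /cycle_Ye; case: cyclet; rewrite ?scaler0.
Qed.

Let Xkill (a : 'I_n) s : s \in cycle_max a -> sigma s *: cycle_Xe a.+1 = 0.
Proof. exact: cycle_Xe_eq0. Qed.
Let Ykill (a : 'I_n) s : s \in cycle_max a -> aut_inv sigma s *: cycle_Ye a.+1 = 0.
Proof. exact: cycle_Ye_eq0. Qed.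

Lemma cycle_eE (a : 'I_n) : cycle_e a.+1 = delta cycle_max (pred1 a).
Proof.
apply: delta_ext => b /=; rewrite -(add1n b) -(add1n a) eqn_modDl.
by rewrite !modn_small ?ltn_ord.
Qed.

Lemma cycle_e_mod k k' : (k = k' %[mod n])%N -> cycle_e k = cycle_e k'.
Proof. by move=> kk'; apply: delta_ext => a; rewrite kk'. Qed.

Lemma cyclet_mod k k' : (k = k' %[mod n])%N -> cyclet w k = cyclet w k'.
Proof. by move=> kk'; rewrite /cyclet -modnDml kk' modnDml. Qed.

Lemma modn_S k k' : (k = k' %[mod n])%N -> (k.+1 = k'.+1 %[mod n])%N.
Proof. by move=> kk'; rewrite -(add1n k) -(add1n k') -modnDmr kk' modnDmr. Qed.

Lemma modn_S_inj k k' : (k.+1 = k'.+1 %[mod n])%N -> (k = k' %[mod n])%N.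
Proof. by move/eqP; rewrite -(add1n k) -(add1n k') eqn_modDl => /eqP. Qed.

Lemma cycle_Xe_mod k k' : (k = k' %[mod n])%N -> cycle_Xe k = cycle_Xe k'.
Proof.
by move=> kk'; rewrite /cycle_Xe (cyclet_mod kk') (cycle_e_mod (modn_S kk')).
Qed.

Lemma cycle_idx k : (0 < n)%N -> exists a : 'I_n, (k = a.+1 %[mod n])%N.
Proof.
move=> n0; exists (Ordinal (ltn_pmod (k + n.-1) n0)) => /=.
by rewrite -addn1 modnDml -addnA addn1 prednK // modnDr.
Qed.

Lemma cycle_X_e k : (0 < n)%N -> cycle_X (cycle_e k) = cycle_Xe k.
Proof.
move=> /(cycle_idx k)[a ka]; rewrite (cycle_e_mod ka) cycle_eE.
by rewrite /cycle_X (semilin_delta Xkill) (cycle_Xe_mod ka).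
Qed.

Lemma cycle_Y_e k : (0 < n)%N -> cycle_Y (cycle_e k.+1) = cycle_Ye k.+1.
Proof.
move=> /(cycle_idx k.+1)[a ka]; rewrite (cycle_e_mod ka) cycle_eE.
rewrite /cycle_Y (semilin_delta Ykill) /cycle_Ye /=.
by rewrite -(cyclet_mod (modn_S_inj ka)) -(cycle_e_mod (modn_S_inj ka)).
Qed.

Lemma cycle_XD : {morph cycle_X : u v / u + v}. Proof. exact: (semilinD Xkill). Qed.
Lemma cycle_YD : {morph cycle_Y : u v / u + v}. Proof. exact: (semilinD Ykill). Qed.
Lemma cycle_XZ s u : cycle_X (s *: u) = sigma s *: cycle_X u.
Proof. exact: (semilinZ Xkill). Qed.
Lemma cycle_YZ s u : cycle_Y (s *: u) = aut_inv sigma s *: cycle_Y u.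
Proof. exact: (semilinZ Ykill). Qed.

Hypothesis wD : in_D sigma m0 t 1 w.

Let t_in k : (0 < n)%N -> cyclet w k != One -> t \in spec_iter sigma k m0.
Proof. by move=> n0; rewrite (in_D_cyclet sigma_p k n0 wD) negbK. Qed.

Lemma cycle_YX u : cycle_Y (cycle_X u) = t *: u.
Proof.
move: u; apply: (dsum_ext (h := fun u => cycle_Y (cycle_X u))) => [u v|s u|a].
- by rewrite cycle_XD cycle_YD.
- by rewrite cycle_XZ cycle_YZ aut_funK.
have n0 : (0 < n)%N by apply: leq_ltn_trans (ltn_ord a).
rewrite -cycle_eE cycle_X_e // /cycle_Xe; set k := a.+1.
have YS := cycle_Y_e k n0; rewrite /cycle_Ye /= in YS.
have tk : cyclet w k != One -> t *: cycle_e k = 0.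
  by move=> /(t_in n0); exact: cycle_e_eq0.
case E : (cyclet w k) in YS tk *.
- by rewrite cycle_YZ YS aut_funK.
- by rewrite YS tk.
- by rewrite (additive_morph0 cycle_YD) tk.
- by rewrite (additive_morph0 cycle_YD) tk.
Qed.

Lemma cycle_XY u : cycle_X (cycle_Y u) = sigma t *: u.
Proof.
move: u; apply: (dsum_ext (h := fun u => cycle_X (cycle_Y u))) => [u v|s u|a].
- by rewrite cycle_YD cycle_XD.
- by rewrite cycle_YZ cycle_XZ aut_invK.
have n0 : (0 < n)%N by apply: leq_ltn_trans (ltn_ord a).
rewrite -cycle_eE cycle_Y_e // /cycle_Ye /=; set k := nat_of_ord a.
have XS := cycle_X_e k n0; rewrite /cycle_Xe in XS.
have tk : cyclet w k != One -> sigma t *: cycle_e k.+1 = 0.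
  by move=> /(t_in n0) tk; rewrite cycle_e_eq0 // mem_spec_iterS.
case E : (cyclet w k) in XS tk *.
- by rewrite XS.
- by rewrite (additive_morph0 cycle_XD) tk.
- by rewrite XS tk.
- by rewrite (additive_morph0 cycle_XD) tk.
Qed.

Definition cycle_ops : gwa_ops sigma t cycle_space :=
  GwaOps cycle_XD cycle_YD cycle_XZ cycle_YZ cycle_YX cycle_XY.

Definition V_cycle : lmodType (gwa sigma t) := gwa_mod_of cycle_ops.

End Cycle.

(* Main.v *)
(* The tensor e_k (x) e'_k' is killed by m_k + m_k' (m_k = sigma^k(m0)), hence
   vanishes unless k = k' mod p; the surviving ones are e_k (x) e'_(k+jp) with
   0 <= j < r, each spanning a copy of R / m_k. For fixed j, X and Y act on them
   by the rules of the word w^[j], up to factors sigma(t), sigma(t') arising at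
   the letter pairs (1, x), (x, 1). These factors are units modulo the relevant
   maximal ideal, so they can be absorbed step by step along the line, which gives
   a homomorphism V^(tt')(omega, i, w^[j]) -> V^t (x) V^t' for each j; the sum of
   these over j is bijective. *)

From HB Require Import structures.
Require Import Defs.
From mathcomp Require Import all_boot all_order all_algebra.
From mathcomp Require Import boolp.

Set Implicit Arguments.
Unset Strict Implicit.
Unset Printing Implicit Defensive.

Import GRing.Theory.
Local Open Scope ring_scope.

(** * Projections between quotients by nested ideals *)

Section IdealQuotientMap.
Variables (R : comNzRingType) (I J : idealr R).
Hypothesis IJ : {subset I <= J}.

(** Computed on a representative; the inclusion of [I] in [J] makes it the canonical projection. *)
Definition iquot_map (x : iquot I) : iquot J := ipi J (irepr x).

Lemma iquot_map_pi s : iquot_map (ipi I s) = ipi J s.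
Proof. by apply/ipi_eq/IJ/ipi_eq; rewrite ireprK. Qed.

Lemma iquot_mapD : {morph iquot_map : x y / x + y}.
Proof.
by move=> x y; rewrite -(ireprK x) -(ireprK y) -ipiD !iquot_map_pi ipiD.
Qed.

Lemma iquot_mapZ s x : iquot_map (s *: x) = ipi J s * iquot_map x.
Proof. by rewrite -(ireprK x) iquot_scaleE -ipiM !iquot_map_pi ipiM. Qed.

End IdealQuotientMap.

(** * Homomorphisms out of a line module *)

(* The universal property of V^t(omega, i, w): a family h of vectors of N
   satisfying the relations of the basis e_k extends to a homomorphism. *)
Section LineLift.
Variables (R : comNzRingType) (sigma : ringAut R) (m0 : maxSpec R).
Variables (p : nat) (t : R) (i l : nat) (w : l.-tuple letter).
Hypothesis ok : line_defined sigma m0 p t i w.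
Variables (N : lmodType (gwa sigma t)) (h : nat -> N).

Local Notation c := (gwa_const sigma t).
Local Notation e := (line_e sigma m0 i l).

Definition line_lift (v : V_line ok) : N :=
  \sum_(a < l.+1)
    c (irepr (dsum_fun (v : line_space sigma m0 i l) a)) *: h (i.+1 + a).

Hypothesis h_kill : forall k s, s \in spec_iter sigma k m0 -> c s *: h k = 0.
Hypothesis hX : forall k, (i < k <= (i + l).+1)%N ->
  gwa_X sigma t *: h k = if k == (i + l).+1 then 0 else
    match wlet i.+1 w k with
    | One => c (sigma t) *: h k.+1 | Lx => h k.+1 | Ly | Zero => 0 end.
Hypothesis hY : forall k, (i < k <= (i + l).+1)%N ->
  gwa_Y sigma t *: h k = if k == i.+1 then 0 else
    match wlet i.+1 w k.-1 with
    | One | Ly => h k.-1 | Lx | Zero => 0 end.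

(** Coefficients matter only modulo the maximal ideal killing [h], so the representatives chosen in
    [line_lift] are harmless. *)
Lemma line_lift_coef (a : 'I_l.+1) r s :
  ipi (line_max sigma m0 i a) r = ipi (line_max sigma m0 i a) s ->
  c r *: h (i.+1 + a) = c s *: h (i.+1 + a).
Proof.
move=> /ipi_eq/h_kill rs; by rewrite -(subrK s r) gwa_constD scalerDl rs add0r.
Qed.

Lemma line_liftD : {morph line_lift : u v / u + v}.
Proof.
move=> u v; rewrite /line_lift -big_split; apply: eq_bigr => a _ /=.
rewrite -scalerDl -gwa_constD; apply: line_lift_coef.
rewrite ireprK ipiD !ireprK.
exact: (dsumDE (u : line_space sigma m0 i l) v a).
Qed.

Lemma line_lift_scale r (u : line_space sigma m0 i l) :
  line_lift (r *: u : line_space sigma m0 i l) = c r *: line_lift u.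
Proof.
rewrite /line_lift scaler_sumr; apply: eq_bigr => a _ /=.
rewrite scalerA -gwa_constM; apply: line_lift_coef.
by rewrite ireprK ipiM ireprK dsumZE.
Qed.

Lemma line_lift_e k : (i < k <= (i + l).+1)%N -> line_lift (e k : V_line ok) = h k.
Proof.
move=> /line_idx[a ->]; rewrite line_eE /line_lift (bigD1 a) //= big1 => [|b ba].
  rewrite addr0 -[RHS]scale1r -gwa_const1; apply: line_lift_coef.
  by rewrite ireprK deltaE /= eqxx ipi1.
rewrite (@line_lift_coef _ _ 0); last by rewrite ireprK deltaE /= (negPf ba) ipi0.
by apply: h_kill; rewrite rpred0.
Qed.

Lemma line_lift0 : line_lift 0 = 0.
Proof. exact: (additive_morph0 line_liftD). Qed.

Lemma line_lift_sum I (s : seq I) (F : I -> V_line ok) :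
  line_lift (\sum_(x <- s) F x) = \sum_(x <- s) line_lift (F x).
Proof. exact: (big_morph _ line_liftD line_lift0). Qed.

Lemma line_lift_X (u : V_line ok) :
  line_lift (gwa_X sigma t *: u) = gwa_X sigma t *: line_lift u.
Proof.
rewrite gwa_mod_XE /= /line_X /semilin.
rewrite (line_lift_sum (index_enum _)) scaler_sumr; apply: eq_bigr => a _.
rewrite line_lift_scale scalerA gwa_Xr -scalerA.
congr (_ *: _); set k := (i.+1 + a)%N.
have kl : (i < k <= (i + l).+1)%N.
  by rewrite leq_addr /= /k addSn ltnS leq_add2l -ltnS.
rewrite hX // /line_Xe; case: ifP => [_|kNl]; first exact: line_lift0.
have kS : (i < k.+1 <= (i + l).+1)%N.
  case/andP: kl => ik; rewrite leq_eqVlt kNl => kl.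
  by rewrite ltnS (ltnW ik).
case: wlet; try exact: line_lift0; last by rewrite line_lift_e.
by rewrite line_lift_scale line_lift_e.
Qed.

Lemma line_lift_Y (u : V_line ok) :
  line_lift (gwa_Y sigma t *: u) = gwa_Y sigma t *: line_lift u.
Proof.
rewrite gwa_mod_YE /= /line_Y /semilin.
rewrite (line_lift_sum (index_enum _)) scaler_sumr; apply: eq_bigr => a _.
rewrite line_lift_scale scalerA gwa_Yr -scalerA.
congr (_ *: _); set k := (i.+1 + a)%N.
have kl : (i < k <= (i + l).+1)%N.
  by rewrite leq_addr /= /k addSn ltnS leq_add2l -ltnS.
rewrite hY // /line_Ye; case: ifP => [_|kNi]; first exact: line_lift0.
have kP : (i < k.-1 <= (i + l).+1)%N.
  case: k kl kNi => // k /andP[ik kl] kNi /=.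
  by rewrite ltn_neqAle -ltnS ik eq_sym -eqSS kNi ltnW.
by case: wlet; try exact: line_lift0; rewrite line_lift_e.
Qed.

(** The scalars commuting with [line_lift] are closed under the ring operations, so constants, $X$
    and $Y$ suffice. *)
Lemma line_liftZ a (u : V_line ok) : line_lift (a *: u) = a *: line_lift u.
Proof.
move: a u; apply: gwa_ind => [r|||a IH|a b IHa IHb|a b IHa IHb] u.
- by rewrite gwa_mod_constE line_lift_scale.
- exact: line_lift_X.
- exact: line_lift_Y.
- by rewrite !scaleNr (additive_morphN line_liftD) IH.
- by rewrite !scalerDl line_liftD IHa IHb.
- by rewrite -!scalerA IHa IHb.
Qed.

End LineLift.

(** * Basis tensors of a line and a cycle *)

Section LineCycle.
Variables (R : comNzRingType) (sigma : ringAut R) (p : nat).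
Hypothesis sigma_p : forall u : R, iter p sigma u = u.
Variables (m0 : maxSpec R) (t t' : R) (i l : nat) (w : l.-tuple letter).
Hypothesis w_def : line_defined sigma m0 p t i w.
Variables (r : nat) (r_gt0 : (0 < r)%N) (w' : (r * p).-tuple letter).
Hypothesis w'_D : in_D sigma m0 t' 1 w'.

Local Notation n := (r * p)%N.
Local Notation M := (V_line w_def).
Local Notation N := (V_cycle sigma_p w'_D).
Local Notation T := (gwa_tens M N).
Local Notation m k := (spec_iter sigma k m0).
Local Notation c := (gwa_const sigma (t * t')).
Local Notation e := (line_e sigma m0 i l).
Local Notation e' := (cycle_e sigma m0 p r).
Local Notation P j := (V_line (line_defined_prod sigma_p j r_gt0 w_def w'_D)).

Let p_gt0 : (0 < p)%N.
Proof. by case: w_def => ip _ _ _; apply: leq_trans ip. Qed.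

Let n_gt0 : (0 < n)%N.
Proof. by rewrite muln_gt0 r_gt0 p_gt0. Qed.

(** Typing the factors by the underlying sums lets basis vectors be tensored directly inside the
    $A(tt')$-module. *)
Definition ptens (u : line_space sigma m0 i l) (v : cycle_space sigma m0 p r) : T :=
  pure (u : res_mod M) (v : res_mod N).

Lemma ptensDl u u' v : ptens (u + u') v = ptens u v + ptens u' v.
Proof. exact: pureDl. Qed.
Lemma ptensDr u v v' : ptens u (v + v') = ptens u v + ptens u v'.
Proof. exact: pureDr. Qed.
Lemma ptens0l v : ptens 0 v = 0.
Proof. exact: (additive_morph0 (fun u u' => ptensDl u u' v)). Qed.
Lemma ptens0r u : ptens u 0 = 0.
Proof. exact: (additive_morph0 (ptensDr u)). Qed.

Lemma ptensZl s u v : ptens (s *: u) v = c s *: ptens u v.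
Proof.
by rewrite gwa_mod_constE [RHS]scale_pure res_scaleE gwa_mod_constE.
Qed.

Lemma ptensZr s u v : ptens u (s *: v) = c s *: ptens u v.
Proof.
by rewrite gwa_mod_constE [RHS]scale_pure pureZ res_scaleE gwa_mod_constE.
Qed.

Lemma ptens_X k k' : (i < k <= (i + l).+1)%N ->
  gwa_X sigma (t * t') *: ptens (e k) (e' k') =
  ptens (line_Xe sigma m0 t i w k) (cycle_Xe sigma m0 t' w' k').
Proof.
move=> ik; rewrite gwa_mod_XE /= [LHS]gtX_pure !gwa_mod_XE /=.
by rewrite line_X_e // cycle_X_e // n_gt0.
Qed.

Lemma ptens_Y k k' : (i < k <= (i + l).+1)%N ->
  gwa_Y sigma (t * t') *: ptens (e k) (e' k'.+1) =
  ptens (line_Ye sigma m0 i w k) (cycle_Ye sigma m0 w' k'.+1).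
Proof.
move=> ik; rewrite gwa_mod_YE /= [LHS]gtY_pure !gwa_mod_YE /=.
by rewrite line_Y_e // cycle_Y_e // n_gt0.
Qed.

(** * Rescaled basis tensors *)

(* X sends e_k (x) e'_(k+jp) to sigma(t) or sigma(t')
   times the next basis tensor when the letters are (1, x) or (x, 1), although
   their product is x. Rescaling by [twist] absorbs this factor; it is a unit
   modulo sigma^(k+1)(m0), being attached to a letter 1. *)
Definition twist_step j k : R :=
  match wlet i.+1 w k, cyclet w' (k + j * p) with
  | One, Lx => sigma t | Lx, One => sigma t' | _, _ => 1 end.

(* The coefficient attached to the index k = i + 1 + a. *)
Fixpoint twist j a : R :=
  if a is b.+1 then sigma (twist j b) * twist_step j (i.+1 + b) else 1.

Lemma twist_step_notin j k : (i < k <= i + l)%N -> twist_step j k \notin m k.+1.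
Proof.
move=> ik; rewrite /twist_step; case: w_def => _ _ wD _.
have := wD k; rewrite size_tuple => /(_ ik).
have := in_D_cyclet sigma_p (k + j * p) n_gt0 w'_D.
(* By periodicity the letter of [w'] at [k + j * p] also tests [t'] against [m k]. *)
rewrite in_B_period //.
case: wlet; case: cyclet => //=; rewrite ?idealr1 // mem_spec_iterS.
  by move=> _ /esym.
by move=> /esym.
Qed.

(** Induction along the line: $\sigma$ carries each maximal ideal to the next, and maximal ideals
    are prime. *)
Lemma twist_notin j a : (a <= l)%N -> twist j a \notin m (i.+1 + a).
Proof.
elim: a => [|a IH] al; first by rewrite idealr1.
rewrite addnS -[twist j a.+1]/(_ * _) maxSpec_prime negb_or mem_spec_iterS.
rewrite IH ?(ltnW al) // twist_step_notin // leq_addr /=.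
by rewrite addSn -addnS leq_add2l.
Qed.

(** The image of $e_k$ from the $j$-th summand; the rescaling starts with coefficient 1 at the left
    end $k=i+1$. *)
Definition ptwist j k : T :=
  c (twist j (k - i.+1)) *: ptens (e k) (e' (k + j * p)).

Lemma ptwist_kill j k s : s \in m k -> c s *: ptwist j k = 0.
Proof.
move=> sk; rewrite /ptwist scalerA -gwa_constM [s * _]mulrC gwa_constM -scalerA.
by rewrite -ptensZl line_e_eq0 // ptens0l scaler0.
Qed.

Lemma wlet_prod j k : (i < k <= i + l)%N ->
  wlet i.+1 (word_prod p i w w' j) k =
  letter_mul (wlet i.+1 w k) (cyclet w' (k + j * p)).
Proof.
move=> /andP[ik kl]; have kl' : (k - i.+1 < l)%N by rewrite ltn_subLR.
rewrite {1}/wlet -[(k - i.+1)%N]/(nat_of_ord (Ordinal kl')) -tnth_nth.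
by rewrite tnth_mktuple /= subnKC.
Qed.

Lemma ptwist_X j k : (i < k <= (i + l).+1)%N ->
  gwa_X sigma (t * t') *: ptwist j k = if k == (i + l).+1 then 0 else
    match wlet i.+1 (word_prod p i w w' j) k with
    | One => c (sigma (t * t')) *: ptwist j k.+1
    | Lx => ptwist j k.+1 | Ly | Zero => 0 end.
Proof.
move=> ik; rewrite /ptwist scalerA gwa_Xr -scalerA ptens_X // /line_Xe.
case: ifP => [_|kNl]; first by rewrite ptens0l scaler0.
have ikl : (i < k <= i + l)%N.
  by case/andP: ik => ->; rewrite leq_eqVlt kNl.
rewrite wlet_prod // subSn /=; last by case/andP: ikl.
rewrite /twist_step subnKC /cycle_Xe; last by case/andP: ikl.
rewrite addSn.
(* Pairs with product y or 0 have a vanishing factor. Pairs with product x produce exactly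
   [twist_step], and (1,1) produces $\sigma(t)\sigma(t')$. *)
case: wlet; case: cyclet => /=; rewrite ?ptens0l ?ptens0r ?scaler0 //;
  rewrite ?ptensZl ?ptensZr ?scalerA -?gwa_constM ?mulr1 //.
by rewrite [sigma (t * t') * _]mulrC rmorphM mulrA.
Qed.

Lemma ptwist_Y j k : (i < k <= (i + l).+1)%N ->
  gwa_Y sigma (t * t') *: ptwist j k = if k == i.+1 then 0 else
    match wlet i.+1 (word_prod p i w w' j) k.-1 with
    | One | Ly => ptwist j k.-1 | Lx | Zero => 0 end.
Proof.
case: k => // k ik; rewrite /ptwist scalerA gwa_Yr -scalerA ptens_Y // /line_Ye.
case: ifP => [_|kNi]; first by rewrite ptens0l scaler0.
have ikl : (i < k <= i + l)%N.
  by case/andP: ik => ik kl; rewrite ltn_neqAle -ltnS ik eq_sym -eqSS kNi.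
rewrite /= wlet_prod // subSn /=; last by case/andP: ikl.
rewrite /twist_step subnKC /cycle_Ye /=; last by case/andP: ikl.
(* The surviving pairs have product 1 or y; there [twist_step] is 1, and $\sigma^{-1}$ restores the
   previous coefficient. *)
case: wlet; case: cyclet => /=; rewrite ?ptens0l ?ptens0r ?scaler0 //;
  by rewrite mulr1 aut_funK.
Qed.

(** * The homomorphism from the direct sum *)

Definition sum_lift (y : dsum (fun j : 'I_r => P j)) : T :=
  \sum_(j < r) line_lift (ptwist j) (y j).

Lemma sum_liftD : {morph sum_lift : x y / x + y}.
Proof.
move=> x y; rewrite /sum_lift -big_split; apply: eq_bigr => j _ /=.
by rewrite dsumDE line_liftD //; apply: ptwist_kill.
Qed.

Lemma sum_liftZ a y : sum_lift (a *: y) = a *: sum_lift y.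
Proof.
rewrite /sum_lift scaler_sumr; apply: eq_bigr => j _.
rewrite dsumZE line_liftZ //.
- exact: ptwist_kill.
- exact: ptwist_X.
- exact: ptwist_Y.
Qed.

(** * Coordinates on the tensor product, and injectivity *)

Section Coordinate.
Variables (a : 'I_l.+1) (b : 'I_n).
Hypothesis ab : m b.+1 =i m (i.+1 + a).

Local Notation Ra := (iquot (line_max sigma m0 i a)).

(* On the tensor product of the summands R / m_k and R / m_k', which are the same
   field when m_k = m_k', this is multiplication. *)
Definition coord_fun (u : res_mod M) (v : res_mod N) : Ra :=
  dsum_fun (u : line_space sigma m0 i l) a *
  iquot_map _ (dsum_fun (v : cycle_space sigma m0 p r) b).

Definition coord : T -> Ra := tens_lift coord_fun.

Let sub : {subset cycle_max sigma m0 b <= line_max sigma m0 i a}.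
Proof. by move=> x; rewrite ab. Qed.

Lemma coord_funDl u1 u2 v : coord_fun (u1 + u2) v = coord_fun u1 v + coord_fun u2 v.
Proof. by rewrite /coord_fun (dsumDE (u1 : line_space sigma m0 i l)) mulrDl. Qed.

Lemma coord_funDr u v1 v2 : coord_fun u (v1 + v2) = coord_fun u v1 + coord_fun u v2.
Proof.
by rewrite /coord_fun (dsumDE (v1 : cycle_space sigma m0 p r)) (iquot_mapD sub) mulrDr.
Qed.

Lemma coord_funZ s u v : coord_fun (s *: u) v = coord_fun u (s *: v).
Proof.
rewrite /coord_fun !res_scaleE !gwa_mod_constE !dsumZE (iquot_mapZ sub).
by rewrite [X in X * _ = _]iquot_scaleE mulrCA mulrA.
Qed.

Lemma coordD : {morph coord : x y / x + y}.
Proof. exact: (tens_liftD coord_funDl coord_funDr coord_funZ). Qed.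

Lemma coord_pure u v : coord (ptens u v) =
  dsum_fun u a * iquot_map _ (dsum_fun v b).
Proof. exact: (tens_lift_pure coord_funDl coord_funDr coord_funZ). Qed.

Lemma coordZ s x : coord (c s *: x) = ipi _ s * coord x.
Proof.
rewrite gwa_mod_constE; move: x.
apply: (tens_ext (f := fun x => coord (s *: x)) (g := fun x => ipi _ s * coord x)).
- by move=> x y; rewrite scalerDr; exact: coordD.
- by move=> x y; rewrite -mulrDr; congr (_ * _); exact: coordD.
move=> u v; have := coord_pure (s *: (u : line_space sigma m0 i l)) v.
rewrite ptensZl gwa_mod_constE => ->.
by rewrite [coord _]coord_pure mulrA dsumZE.
Qed.

Lemma coord_e (a' : 'I_l.+1) k :
  coord (ptens (e (i.+1 + a')) (e' k)) = ((a' == a) && (b.+1 == k %[mod n]))%:R.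
Proof.
rewrite coord_pure line_eE !deltaE /= eq_sym.
case: eqP => _ /=; last by rewrite mul0r.
rewrite mul1r; case: eqP => _.
  by rewrite -ipi1 (iquot_map_pi sub) ipi1.
by rewrite -ipi0 (iquot_map_pi sub) ipi0.
Qed.

Lemma coord_sum I (s : seq I) (Q : pred I) (F : I -> T) :
  coord (\sum_(x <- s | Q x) F x) = \sum_(x <- s | Q x) coord (F x).
Proof. exact: (big_morph _ coordD (additive_morph0 coordD)). Qed.

End Coordinate.

Lemma spec_iter_shift j k k' :
  (k + j * p = k' %[mod n])%N -> m k' =i m k.
Proof.
move=> kk' x; rewrite -(spec_iter_mod m0 sigma_p kk'); exact: spec_iter_period.
Qed.

(** The multiples $jp$ with $j<r$ are below $rp$, hence distinct modulo $rp$. *)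
Lemma shift_inj (j j' : 'I_r) k : (k + j * p == k + j' * p %[mod n])%N -> j = j'.
Proof.
rewrite eqn_modDl !modn_small ?ltn_pmul2r ?p_gt0 // eqn_pmul2r ?p_gt0 //.
by move/eqP/val_inj.
Qed.

(** The coordinate isolates one term: [a] fixes the position on the line and [b] then fixes [j], by
    [shift_inj]. *)
Lemma coord_sum_lift (y : dsum (fun j : 'I_r => P j)) (j : 'I_r) (a : 'I_l.+1)
    (b : 'I_n) :
  (i.+1 + a + j * p = b.+1 %[mod n])%N ->
  coord a b (sum_lift y) =
    ipi _ (twist j a) * dsum_fun (y j : line_space sigma m0 i l) a.
Proof.
move=> jab; have ab := spec_iter_shift jab.
have term (j' : 'I_r) (a' : 'I_l.+1) s : coord a b (c s *: ptwist j' (i.+1 + a')) =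
    ipi _ s * (ipi _ (twist j' a') * ((a' == a) && (j' == j))%:R).
  rewrite !coordZ // coord_e // addKn; congr (_ * (_ * (nat_of_bool _)%:R)).
  case: eqP => // -> /=; rewrite -jab; apply/idP/eqP => [|->//].
  by move/shift_inj ->.
rewrite /sum_lift coord_sum // (bigD1 j) //= [X in _ + X]big1 => [|j' jj'].
  rewrite addr0 /line_lift coord_sum // (bigD1 a) //= [X in _ + X]big1 => [|a' aa'].
    by rewrite addr0 term !eqxx mulr1 ireprK mulrC.
  by rewrite term (negPf aa') !mulr0.
rewrite /line_lift coord_sum // big1 // => a' _.
by rewrite term (negPf jj') andbF !mulr0.
Qed.

Lemma sum_lift_eq0 y : sum_lift y = 0 -> y = 0.
Proof.
move=> y0; apply: dsumP => j; rewrite dsum0E.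
apply: (@dsumP _ _ _ (y j : line_space sigma m0 i l) 0) => a; rewrite dsum0E.
have [b jab] := cycle_idx (i.+1 + a + j * p) n_gt0.
have := coord_sum_lift y jab.
rewrite y0 (additive_morph0 (coordD (spec_iter_shift jab))) => /esym d0.
have al : (a <= l)%N by rewrite -ltnS.
(* [s] inverts the twist modulo the maximal ideal, so the coefficient itself is 0. *)
have [s sd] := maxSpec_bezout (twist_notin j al).
rewrite -[LHS]mul1r -ipi1 -(subrK (s * twist j a) 1) ipiD ipiM.
have /ipi_eq0 -> : 1 - s * twist j a \in line_max sigma m0 i a by exact: sd.
by rewrite add0r -mulrA d0 mulr0.
Qed.

(** * Surjectivity *)

Hypothesis orbit_p : forall a b : nat, (a < p)%N -> (b < p)%N ->
  m a =i m b -> a = b.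

Lemma orbit_eqmod k k' : m k =i m k' -> (k = k' %[mod p])%N.
Proof.
move=> kk'; apply: orbit_p; rewrite ?ltn_pmod ?p_gt0 // => x.
move: (kk' x); rewrite {1}(divn_eq k p) {1}(divn_eq k' p).
by rewrite ![(_ * p + _)%N]addnC !spec_iter_period.
Qed.

Lemma shift_surj k k' : (k = k' %[mod p])%N ->
  exists j : 'I_r, (k + j * p = k' %[mod n])%N.
Proof.
move=> kk'; have pn : (p %| n)%N by rewrite dvdn_mull.
(* Adding $kn$ keeps the residue of $k'$ modulo $n$ and prevents truncation when $k$ is
   subtracted. *)
have le : (k <= k' + k * n)%N.
  by rewrite (leq_trans _ (leq_addl _ _)) // leq_pmulr // n_gt0.
have /dvdnP[q qE] : (p %| k' + k * n - k)%N.
  rewrite -eqn_mod_dvd // -modnDmr -modnMmr (eqP pn) muln0 mod0n addn0.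
  by apply/eqP.
(* Reducing $q$ modulo $r$ changes $qp$ by a multiple of $rp$. *)
exists (Ordinal (ltn_pmod q r_gt0)) => /=.
by rewrite muln_modl modnDmr -qE subnKC // addnC modnMDl.
Qed.

(* Distinct maximal ideals are comaximal and their sum kills the tensor. *)
Lemma ptens_coprime k k' : ~ (m k =i m k') -> ptens (e k) (e' k') = 0.
Proof.
(* Without such an [s], [m k] would lie in [m k'], and maximality would force equality. *)
move=> kk'; have [s sk sk'] : exists2 s, s \in m k & s \notin m k'.
  apply: contrapT => nex; apply: kk' => x.
  have sub : {subset m k <= m k'}.
    move=> y yk; case: (boolP (y \in m k')) => // yk'.
    by case: nex; exists y.
  by apply/idP/idP => [/sub//|]; exact: ms_maximal.
have [x xs] := maxSpec_bezout sk'.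
rewrite -[LHS]scale1r -gwa_const1 -(subrK (x * s) 1) gwa_constD scalerDl.
rewrite -ptensZr cycle_e_eq0 // ptens0r add0r gwa_constM -scalerA.
by rewrite -ptensZl line_e_eq0 // ptens0l scaler0.
Qed.

Lemma sum_lift_e (j : 'I_r) (a : 'I_l.+1) :
  exists y, sum_lift y = ptwist j (i.+1 + a).
Proof.
exists (mkdsum (V := fun j : 'I_r => P j)
  (fun j' => if j' == j then e (i.+1 + a) : P j' else 0)).
rewrite /sum_lift (bigD1 j) //= big1 => [|j' jj'].
  rewrite mkdsumE eqxx addr0 line_lift_e //; first exact: ptwist_kill.
  by rewrite leq_addr /= addSn ltnS leq_add2l -ltnS.
by rewrite mkdsumE (negPf jj') line_lift0 //; apply: ptwist_kill.
Qed.

(** Either the ideals differ and the tensor is 0, or it is some [ptwist] up to a scalar invertible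
    modulo the common ideal. *)
Lemma sum_lift_ptens_e (a : 'I_l.+1) (b : 'I_n) :
  exists y, sum_lift y = ptens (e (i.+1 + a)) (e' b.+1).
Proof.
case: (pselect (m (i.+1 + a) =i m b.+1)) => [ab|/ptens_coprime ->]; last first.
  by exists 0; rewrite (additive_morph0 sum_liftD).
have [j jab] := shift_surj (orbit_eqmod ab).
have al : (a <= l)%N by rewrite -ltnS.
have [s sd] := maxSpec_bezout (twist_notin j al).
have [y yE] := sum_lift_e j a.
exists (c s *: y); rewrite sum_liftZ yE /ptwist addKn (cycle_e_mod sigma m0 jab).
rewrite scalerA -gwa_constM -[RHS]scale1r -gwa_const1 -(subrK (s * twist j a) 1).
by rewrite gwa_constD scalerDl -[X in _ = X + _]ptensZl line_e_eq0 // ptens0l add0r.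
Qed.

(** The image is a submodule, and expanding both factors of a pure tensor reduces to basis
    tensors. *)
Lemma sum_lift_surj x : exists y, sum_lift y = x.
Proof.
have im_sum I (s : seq I) (F : I -> T) :
    (forall k, exists y, sum_lift y = F k) ->
    exists y, sum_lift y = \sum_(k <- s) F k.
  move=> FP; elim/big_rec: _ => [|k _ _ [y <-]].
    by exists 0; rewrite (additive_morph0 sum_liftD).
  by have [z <-] := FP k; exists (z + y); rewrite sum_liftD.
move: x; apply: tens_ind => [|u v|x [y <-]|x y [x' <-] [y' <-]].
- by exists 0; rewrite (additive_morph0 sum_liftD).
- rewrite -[pure u v]/(ptens u v) (dsum_delta (u : line_space sigma m0 i l)).
  rewrite (big_morph _ (fun x y => ptensDl x y v) (ptens0l v)).
  apply: (im_sum _) => a; rewrite (dsum_delta (v : cycle_space sigma m0 p r)).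
  rewrite (big_morph _ (ptensDr _) (ptens0r _)).
  apply: im_sum => b; rewrite ptensZl ptensZr -line_eE -cycle_eE scalerA.
  by have [y <-] := sum_lift_ptens_e a b; eexists; rewrite -sum_liftZ.
- by exists (- y); rewrite (additive_morphN sum_liftD).
- by exists (x' + y'); rewrite sum_liftD.
Qed.

End LineCycle.

Theorem lemma3p16 (R : comNzRingType) (sigma : ringAut R) (p : nat)
    (sigma_p : forall u : R, iter p sigma u = u)
    (m0 : maxSpec R)
    (orbit_p : forall a b : nat, (a < p)%N -> (b < p)%N ->
       spec_iter sigma a m0 =i spec_iter sigma b m0 -> a = b)
    (t t' : R) (t_reg : GRing.lreg t) (t'_reg : GRing.lreg t')
    (i l : nat) (w : l.-tuple letter)
    (w_def : line_defined sigma m0 p t i w)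
    (r : nat) (r_gt0 : (0 < r)%N) (w' : (r * p).-tuple letter)
    (w'_D : in_D sigma m0 t' 1 w') :
  exists f : {linear gwa_tens (V_line w_def) (V_cycle sigma_p w'_D)
       -> dsum (fun j : 'I_r =>
            V_line (line_defined_prod sigma_p j r_gt0 w_def w'_D))},
    bijective f.
Proof.
pose G := @sum_lift R sigma p sigma_p m0 t t' i l w w_def r r_gt0 w' w'_D.
have Glin : linear G by move=> a x y; rewrite /G sum_liftD sum_liftZ.
have Ginj : injective G.
  move=> x y xy; apply/eqP; rewrite -subr_eq0; apply/eqP/sum_lift_eq0.
  by rewrite -/G -[- y]scaleN1r addrC Glin scaleN1r xy addNr.
have Gsurj x : exists y, G y = x by exact: sum_lift_surj.
(* The map sought goes the other way: it is the inverse of [G], chosen pointwise and linear because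
   [G] is linear and injective. *)
pose F x := sval (cid (Gsurj x)).
have GF : cancel F G by move=> x; rewrite /F; case: cid.
have FG : cancel G F by move=> y; apply: Ginj; rewrite GF.
have Flin : linear F by move=> a x y; apply: Ginj; rewrite Glin !GF.
pose Fl := HB.pack_for {linear _ -> _} F (GRing.isLinear.Build _ _ _ _ F Flin).
by exists Fl, G.
Qed.
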